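(* Let $d\ge2$ be an integer. Let $\mathbb{G}<\mathrm{GL}_d$ be a connected algebraic group over $\mathbb{C}$ for which the standard representation $\mathbb{C}^d$ is irreducible. Let $\mathbb{G}_{\mathbb{R}}<\mathrm{GL}_{2d}$ denote the restriction of scalars of $\mathbb{G}$ to the ground field $\mathbb{R}$ and let $G<\mathrm{GL}_{2d}(\mathbb{R})$ be the group of $\mathbb{R}$-points of $\mathbb{G}_{\mathbb{R}}$. Then the action of $G$ on $\mathbb{R}^{2d}$ is strongly irreducible, has proximal dimension $2$, and satisfies property (S).
   Context: Concretely, identifying $\mathbb{C}^d$ with $\mathbb{R}^{2d}$ and viewing $\mathrm{GL}_d(\mathbb{C})$ as a subgroup of $\mathrm{GL}_{2d}(\mathbb{R})$, the group $G$ is $\mathbb{G}(\mathbb{C})$ regarded as a subgroup of $\mathrm{GL}_{2d}(\mathbb{R})$. An action on $\mathbb{R}^m$ is strongly irreducible if it preserves no finite union of nonzero proper real linear subspaces. For a subsemigroup $\Gamma\subset\mathrm{GL}_m(\mathbb{R})$, let $\overline{\mathbb{R}\Gamma}$ be the closure in $\mathrm{End}(\mathbb{R}^m)$ of $\{\lambda g\mid\lambda\in\mathbb{R},\ g\in\Gamma\}$. The proximal dimension is $r_\Gamma=\min\{\operatorname{rk}\pi\mid\pi\in\overline{\mathbb{R}\Gamma}\setminus\{0\}\}$ (real rank). Put $\Pi_\Gamma=\{\pi\in\overline{\mathbb{R}\Gamma}\mid\operatorname{rk}\pi=r_\Gamma\}$ and $\mathcal{L}_\Gamma=\{\operatorname{im}\pi\mid\pi\in\Pi_\Gamma\}\subset\mathrm{Gr}(r_\Gamma,m)$,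 with $\mathrm{Gr}(k,m)$ the Grassmannian of $k$-dimensional real linear subspaces of $\mathbb{R}^m$. $\Gamma$ has property (S) if for every $W\in\mathrm{Gr}(m-r_\Gamma,m)$ there is $V\in\mathcal{L}_\Gamma$ with $V\cap W=\{0\}$. *)

(* Defs.v *)
From HB Require Import structures.
From mathcomp Require Import all_boot all_order all_algebra.
From mathcomp Require Import all_classical all_reals all_analysis.
From mathcomp Require Import complex.
(* The notations of mpoly clash with those of mathcomp-analysis. *)
From mathcomp Require Import -(notations) mpoly.

Set Implicit Arguments.
Unset Strict Implicit.
Unset Printing Implicit Defensive.

Import Order.TTheory GRing.Theory Num.Theory.
Import numFieldNormedType.Exports.

Local Open Scope classical_set_scope.
Local Open Scope ring_scope.

(* Matrices act on column vectors on the left; linfun (mulmx A) is the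
   endomorphism v |-> A *m v. *)

Section LinearAlgebraicGroups.
Variables (F : fieldType) (n : nat).
Implicit Types (G Z : set 'M[F]_n).

(* Z is a Zariski-closed subset of GL_n(F). Allowing 1/det as a further
   function would not change the closed sets, since det is invertible on
   GL_n. *)
Definition zariski_closed Z : Prop :=
  exists S : set (mpoly (n * n) F),
    Z = [set A | A \in unitmx /\
           forall p, S p -> meval (fun k => mxvec A ord0 k) p = 0].

Definition matrix_group G : Prop :=
  [/\ G `<=` [set A | A \in unitmx],
      G 1%:M,
      forall A B, G A -> G B -> G (A *m B) &
      forall A, G A -> G (invmx A)].

(* When F is an algebraically closed field of characteristic 0, a linear
   algebraic group is reduced, hence is determined by its set of F-points. *)
Definition algebraic_group G : Prop := matrix_group G /\ zariski_closed G.

Definition zariski_connected G : Prop :=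
  forall Z1 Z2, zariski_closed Z1 -> zariski_closed Z2 ->
    G `<=` Z1 `|` Z2 -> G `&` Z1 `&` Z2 = set0 ->
    G `&` Z1 = set0 \/ G `&` Z2 = set0.

Definition irreducible_action G : Prop :=
  (0 < n)%N /\
  forall U : {vspace 'cV[F]_n},
    (forall A, G A -> (linfun (mulmx A) @: U <= U)%VS) ->
    U = 0%VS \/ U = fullv.

End LinearAlgebraicGroups.

Section RestrictionOfScalars.
Variables (R : realType) (d : nat).

(* C^d is identified with R^(d + d) by z |-> (Re z, Im z); the matrix A + iB
   then acts by the block matrix with rows (A, -B) and (B, A). *)
Definition realify (A : 'M[R[i]]_d) : 'M[R]_(d + d) :=
  block_mx (map_mx (@complex.Re R) A) (- map_mx (@complex.Im R) A)
           (map_mx (@complex.Im R) A) (map_mx (@complex.Re R) A).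

Definition real_points (G : set 'M[R[i]]_d) : set 'M[R]_(d + d) :=
  realify @` G.

End RestrictionOfScalars.

Section RealActions.
Variables (R : realType) (m : nat).
Implicit Types Gamma : set 'M[R]_m.

(* The family s is required to be nonempty because the empty union is
   preserved by everything. *)
Definition strongly_irreducible Gamma : Prop :=
  forall s : seq {vspace 'cV[R]_m}, s != [::] ->
    (forall V, V \in s -> V != 0%VS /\ V != fullv) ->
    let U := [set v : 'cV[R]_m | exists2 V, V \in s & v \in V] in
    ~ (forall g, Gamma g -> mulmx g @` U `<=` U).

Definition closed_cone Gamma : set 'M[R]_m :=
  closure [set M | exists (l : R) (g : 'M[R]_m), Gamma g /\ M = l *: g].

Definition nonzero_ranks Gamma : set nat :=
  [set \rank p | p in closed_cone Gamma `\ 0].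

(* The least element of nonzero_ranks Gamma, and 0 by convention if that set
   is empty. *)
Definition proximal_dim Gamma : nat :=
  xget 0%N [set r | nonzero_ranks Gamma r /\
                    forall k, nonzero_ranks Gamma k -> (r <= k)%N].

Definition min_rank_elements Gamma : set 'M[R]_m :=
  [set p | closed_cone Gamma p /\ \rank p = proximal_dim Gamma].

Definition limit_images Gamma : set {vspace 'cV[R]_m} :=
  [set limg (linfun (mulmx p : 'cV[R]_m -> 'cV[R]_m))
     | p in min_rank_elements Gamma].

Definition property_S Gamma : Prop :=
  forall W : {vspace 'cV[R]_m}, \dim W = (m - proximal_dim Gamma)%N ->
    exists2 V, limit_images Gamma V & (V :&: W = 0)%VS.

End RealActions.

(* Main.v *)
Require Import Defs.
From mathcomp Require Import all_boot all_order all_algebra.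
From mathcomp Require Import all_classical all_reals all_analysis.
From mathcomp Require Import complex.
From mathcomp Require Import finmap ring lra zify.
From mathcomp Require Import -(notations) mpoly.

(** Write C for R[i] and K for the closed cone R G.

    Values of regular functions. Over an uncountable algebraically closed
    field, a rational function on a closed set which omits uncountably many
    values takes only finitely many: if z is omitted then f - z is invertible
    in the coordinate ring, which has countable dimension, so that finitely
    many of the inverses are linearly dependent, and f is a root of a nonzero
    polynomial. In particular a rational function on G that is bounded, or
    real-valued, takes finitely many values.

    Irreducibility. As G is connected, a finite union of subspaces of
    End(C^d) containing G has a member containing G. Since C^d is irreducible,
    for any finite list of nonzero covectors rho_k and vectors v_k some g in G
    satisfies rho_k g v_k <> 0 for all k.

    Proximal dimension. Let P = B Q be a nonzero element of K of least complex
    rank r, with B of size d x r. The r x r matrices h(g) = Q g B vanish or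
    are invertible, and by compactness |h(g)|^(2r) = O(|det h(g)|^2). Hence the
    degree r monomials in the entries of h(g), divided by det h(g), are bounded
    on G, so they take finitely many values, and so do the ratios of entries of
    h(g). If r >= 2 this contradicts the second fact. So r = 1, and P = w rho.

    Property (S). Let W be cut out by v |-> Re(a_1 v) and v |-> Re(a_2 v). If
    C g w meets W outside 0 for all g in G then a_1 g w / a_2 g w is always
    real, hence takes finitely many values, contradicting the second fact.

    Strong irreducibility. A G-invariant finite union U of real subspaces is
    K-invariant. Let V be one of them and e in V. Either P g V = C w for some
    g in G, or the ratios rho g v / rho g e (v in V) are real, hence take
    finitely many values, and V lies in the complex line C e. Thus U contains
    a complex line or is contained in finitely many; in both cases some orbit
    G u lies in a finite union of complex hyperplanes. *)

Set Implicit Arguments.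
Unset Strict Implicit.
Unset Printing Implicit Defensive.

Import Order.TTheory GRing.Theory Num.Theory.
Import numFieldNormedType.Exports.

Local Open Scope classical_set_scope.
Local Open Scope ring_scope.

(** * A Nullstellensatz over uncountable fields *)

Section IdealSpan.
Variable A : comNzRingType.
Implicit Types S T : set A.

Inductive ideal_span S : A -> Prop :=
| ideal_span0 : ideal_span S 0
| ideal_spanMD a p q : S p -> ideal_span S q -> ideal_span S (a * p + q).

Lemma ideal_span_gen S p : S p -> ideal_span S p.
Proof.
move=> Sp; rewrite -[p]mul1r -[_ * _]addr0.
by apply: ideal_spanMD => //; apply: ideal_span0.
Qed.

Lemma ideal_spanD S p q : ideal_span S p -> ideal_span S q ->
  ideal_span S (p + q).
Proof.
move=> + Sq; elim=> [|a s t Ss _ IH]; first by rewrite add0r.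
by rewrite -addrA; apply: ideal_spanMD.
Qed.

Lemma ideal_spanM S a p : ideal_span S p -> ideal_span S (a * p).
Proof.
elim=> [|b s t Ss _ IH]; first by rewrite mulr0; apply: ideal_span0.
by rewrite mulrDr mulrA; apply: ideal_spanMD.
Qed.

Lemma ideal_spanB S p q : ideal_span S p -> ideal_span S q ->
  ideal_span S (p - q).
Proof.
by move=> Sp Sq; rewrite -mulN1r; apply: ideal_spanD => //; apply: ideal_spanM.
Qed.

Lemma ideal_span_sum S (I : Type) (r : seq I) (f : I -> A) :
  (forall i, ideal_span S (f i)) -> ideal_span S (\sum_(i <- r) f i).
Proof.
move=> Sf; elim: r => [|i r IH]; first by rewrite big_nil; apply: ideal_span0.
by rewrite big_cons; apply: ideal_spanD.
Qed.

Lemma ideal_span_sub S T p : (forall q, S q -> ideal_span T q) ->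
  ideal_span S p -> ideal_span T p.
Proof.
move=> ST; elim=> [|a s t Ss _ IH]; first exact: ideal_span0.
by apply: ideal_spanD => //; apply: ideal_spanM; apply: ST.
Qed.

(** Gathering the coefficients of [f] gives [a]. For [p = 1] this says that [f] is a unit modulo [S]
    once [S] and [f] together generate the unit ideal. *)
Lemma ideal_span_adjoin S f p : ideal_span (S `|` [set f]) p ->
  exists a, ideal_span S (p - a * f).
Proof.
elim=> [|a s t Ss _ [b IH]].
  by exists 0; rewrite mul0r subr0; apply: ideal_span0.
case: Ss => [Ss|->].
  by exists b; rewrite -addrA; apply: ideal_spanMD.
by exists (a + b); rewrite mulrDl opprD addrACA subrr add0r.
Qed.

Lemma ideal_span_prod_inv S (I : eqType) (r : seq I) (f : I -> A) :
  (forall i, exists a, ideal_span S (a * f i - 1)) ->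
  ideal_span S (\prod_(i <- r) f i) -> ideal_span S 1.
Proof.
move=> finv; elim: r => [|i r IH]; first by rewrite big_nil.
rewrite big_cons => Sir; apply: IH.
have [a Sa] := finv i; set P := \prod_(j <- r) _ in Sir *.
have -> : P = a * (f i * P) - P * (a * f i - 1).
  by rewrite mulrBr mulr1 opprB addrC [P * _]mulrC mulrA subrK.
by apply: ideal_spanB; apply: ideal_spanM.
Qed.

End IdealSpan.

Lemma lin_dep_rows (F : fieldType) (m k : nat) (A : 'M[F]_(m, k)) :
  (k < m)%N -> exists2 c : 'rV[F]_m, c != 0 & c *m A = 0.
Proof.
move=> km; have : kermx A != 0.
  rewrite kermx_eq0 /row_free neq_ltn.
  by rewrite (leq_ltn_trans (rank_leq_col A)).
move=> /rowV0Pn[c /sub_kermxP cA c0]; by exists c.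
Qed.

Section Nullstellensatz.
Variables (F : closedFieldType) (n : nat).
Implicit Types (S : set (mpoly n F)) (f : mpoly n F) (x : 'I_n -> F).

Definition zeros S : set ('I_n -> F) := [set x | forall p, S p -> meval x p = 0].

Lemma ideal_span_zeros S p x : zeros S x -> ideal_span S p -> meval x p = 0.
Proof.
move=> Sx; elim=> [|a s t Ss _ IH]; first exact: meval0.
by rewrite mevalD mevalM IH (Sx _ Ss) mulr0 addr0.
Qed.

(** The [g i] lie in the span of the monomials indexed by [bmultinom n D]; these are fewer than the
    [g i], so the coefficient rows are dependent. *)
Lemma mpoly_dep (I : finType) (g : I -> mpoly n F) D :
  (forall i, msize (g i) <= D)%N -> (#|{: bmultinom n D}| < #|I|)%N ->
  exists c : I -> F, (exists i, c i != 0) /\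
    \sum_i mpolyC n (c i) * g i = 0.
Proof.
move=> gD MI.
pose A : 'M[F]_(#|I|, #|{: bmultinom n D}|) :=
  \matrix_(i, j) mcoeff (bmnm (enum_val j)) (g (enum_val i)).
have [c c0 cA] := lin_dep_rows A MI.
exists (fun i => c 0 (enum_rank i)); split.
  have [j cj] : exists j, c 0 j != 0 by apply/rV0Pn.
  by exists (enum_val j); rewrite enum_valK.
have -> : \sum_i mpolyC n (c 0 (enum_rank i)) * g i =
  \sum_(m : bmultinom n D) (\sum_i c 0 (enum_rank i) * mcoeff (bmnm m) (g i))
     *: mpolyX F (bmnm m).
  under eq_bigr do rewrite {1}(mpolywE (gD _)).
  under [RHS]eq_bigr do rewrite scaler_suml.
  rewrite exchange_big /=; apply: eq_bigr => i _.
  by rewrite mul_mpolyC scaler_sumr; apply: eq_bigr => m _; rewrite scalerA.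
apply: big1 => m _; rewrite [X in X *: _](_ : _ = 0) ?scale0r//.
have := congr1 (fun B : 'rV_ _ => B 0 (enum_rank m)) cA.
rewrite !mxE => cAm; rewrite -[RHS]cAm (reindex (enum_val : 'I_#|I| -> I)) /=; last first.
  by apply: onW_bij; apply: enum_val_bij.
by apply: eq_bigr => i _; rewrite mxE enum_valK enum_rankK.
Qed.

(** The bounds [D] exhaust [E] by countably many pieces; were all of them finite, [E] would be
    countable. *)
Lemma uncountable_degree (E : set F) (g : F -> mpoly n F) : ~ countable E ->
  exists D, infinite_set [set z | E z /\ (msize (g z) <= D)%N].
Proof.
move=> uE; apply: contrapT => /forallNP fin; apply: uE.
have -> : E = \bigcup_D [set z | E z /\ (msize (g z) <= D)%N].
  apply/seteqP; split=> [z Ez|z [D _ []]//]; by exists (msize (g z)).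
apply: bigcup_countable => // D _; apply: finite_set_countable.
by apply: contrapT; apply: fin.
Qed.

(* The inverses of the f - z lie in a space of countable dimension, so that
   finitely many of them are linearly dependent; clearing denominators in the
   dependence relation gives a polynomial in f. *)
Lemma ideal_span_prod_sub S f (E : set F) : ~ countable E ->
  (forall z, E z -> exists a, ideal_span S (a * (f - mpolyC n z) - 1)) ->
  exists zs : seq F, ideal_span S (\prod_(z <- zs) (f - mpolyC n z)).
Proof.
move=> uE Einv.
have {}Einv z : exists a, E z -> ideal_span S (a * (f - mpolyC n z) - 1).
  by have [/Einv[a]|nEz] := pselect (E z); [exists a | exists 0].
have [g gE] := choice Einv.
have [D infD] := uncountable_degree g uE.
have [B BE MB] := infinite_set_fset #|{: bmultinom n D}|.+1 infD.
have Bp (i : B) : E (val i) /\ (msize (g (val i)) <= D)%N.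
  by apply: BE; exact: (valP i).
have [|c [[k ck] c0]] := @mpoly_dep B (fun i => g (val i)) D (fun i => (Bp i).2).
  by rewrite -cardfE.
(* [q] is the numerator of the sum of the fractions [c i / ('X - val i)]. At [val k] only the [k]-th
   term survives, so [q] is nonzero. *)
pose q : {poly F} := \sum_i c i *: \prod_(j | j != i) ('X - (val j)%:P).
have q0 : q != 0.
  have : q.[val k] != 0.
    rewrite horner_sum (bigD1 k)//= [X in _ + X]big1 ?addr0 => [|i ik]; last first.
      rewrite hornerZ horner_prod (bigD1 k) 1?eq_sym//=.
      by rewrite hornerXsubC subrr mul0r mulr0.
    rewrite hornerZ horner_prod mulf_neq0//.
    apply/prodf_neq0 => j jk; rewrite hornerXsubC subr_eq0.
    by rewrite (inj_eq val_inj) eq_sym.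
  by apply: contraNneq => ->; rewrite horner0.
have [zs qzs] := closed_field_poly_normal q.
have qf : horner_alg f q = mpolyC n (lead_coef q) * \prod_(z <- zs) (f - mpolyC n z).
  rewrite {1}qzs linearZ /= rmorph_prod alg_mpolyC; congr (_ * _).
  apply: eq_bigr => z _; rewrite rmorphB /= horner_algX horner_algC.
  by rewrite alg_mpolyC.
have Sq : ideal_span S (horner_alg f q).
  (* [P] clears denominators: modulo [S], [g (val i) * P] is the product of the factors other than
     the [i]-th, and the dependence relation makes the weighted sum of these vanish. *)
  pose P := \prod_(j : B) (f - mpolyC n (val j)).
  have -> : horner_alg f q = - \sum_i (mpolyC n (c i) *
       \prod_(j | j != i) (f - mpolyC n (val j))) * (g (val i) * (f - mpolyC n (val i)) - 1).
    have -> : horner_alg f q =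
       \sum_i mpolyC n (c i) * \prod_(j | j != i) (f - mpolyC n (val j)).
      rewrite /q linear_sum; apply: eq_bigr => i _.
      rewrite linearZ /= rmorph_prod alg_mpolyC; congr (_ * _).
      apply: eq_bigr => z _; rewrite rmorphB /= horner_algX horner_algC.
      by rewrite alg_mpolyC.
    have cP : \sum_i mpolyC n (c i) * g (val i) * P = 0.
      by rewrite -mulr_suml c0 mul0r.
    rewrite -sumrN -[LHS]subr0 -[X in _ - X]cP -sumrB.
    apply: eq_bigr => i _; rewrite [P](bigD1 i)//=.
    rewrite mulrBr mulr1 opprB; congr (_ - _).
    by rewrite [RHS]mulrACA; congr (_ * _); rewrite mulrC.
  rewrite -[X in ideal_span _ X]mulN1r; apply: ideal_spanM; apply: ideal_span_sum => i.
  by apply: ideal_spanM; apply: gE; case: (Bp i).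
exists zs; have -> : \prod_(z <- zs) (f - mpolyC n z) =
    mpolyC n (lead_coef q)^-1 * horner_alg f q.
  rewrite qf mulrA -mpolyCM mulVf ?mul1r// lead_coef_eq0 //.
exact: ideal_spanM.
Qed.

Hypothesis uF : ~ countable [set: F].

(** If [1] is not in the ideal, coordinates of a zero are chosen one at a time. Were no value [z]
    admissible for the next one, every [X_i - z] would be a unit modulo the ideal, whereas some
    finite product of these lies in it. *)
Lemma weak_nullstellensatz S : zeros S = set0 -> ideal_span S 1.
Proof.
move=> S0; apply: contrapT => S1.
pose adj (s : seq 'I_n) x := S `|`
  [set p | exists2 i, i \in s & p = mpolyX F (mnm1 i) - mpolyC n (x i)].
have [x xP] : exists x, ~ ideal_span (adj (enum 'I_n) x) 1.
  elim: (enum 'I_n) (enum_uniq 'I_n) => [|i s IH] /=.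
    move=> _; exists (fun=> 0) => S1'; apply: S1; move: S1'.
    by apply: ideal_span_sub => q [Sq|[k] //]; apply: ideal_span_gen.
  move=> /andP[is_ us]; have [x xP] := IH us.
  apply: contrapT => /forallNP nx; apply: xP.
  have inv z : exists a, ideal_span (adj s x) (a * (mpolyX F (mnm1 i) - mpolyC n z) - 1).
    have [//|a] := @ideal_span_adjoin _ (adj s x) (mpolyX F (mnm1 i) - mpolyC n z) 1.
      have /contrapT := nx (fun j => if j == i then z else x j).
      apply: ideal_span_sub => q [Sq|[j js ->] ].
        by apply: ideal_span_gen; left; left.
      apply: ideal_span_gen; move: js; rewrite inE; case: eqVneq => [->|ji] /=.
        by right.
      by move=> js; left; right; exists j.
    exists a; rewrite -[_ - 1]opprB -[X in ideal_span _ X]mulN1r; exact: ideal_spanM.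
  have [zs] := ideal_span_prod_sub uF (fun z _ => inv z).
  by apply: ideal_span_prod_inv.
suff : zeros S x by rewrite S0.
(* Once all coordinates are fixed, every polynomial is congruent to its value at [x]; a generator
   not vanishing at [x] would put a nonzero constant in the ideal. *)
have evx p : ideal_span (adj (enum 'I_n) x) (p - mpolyC n (meval x p)).
  have Xi i : ideal_span (adj (enum 'I_n) x) (mpolyX F (mnm1 i) - mpolyC n (x i)).
    by apply: ideal_span_gen; right; exists i; rewrite ?mem_enum.
  elim/mpolyind: p => [|c m p _ _ IH].
    by rewrite meval0 mpolyC0 subrr; apply: ideal_span0.
  rewrite mevalD mpolyCD opprD addrACA; apply: ideal_spanD => //.
  rewrite mevalZ mpolyCM -mul_mpolyC -mulrBr; apply: ideal_spanM.
  have evM q r : ideal_span (adj (enum 'I_n) x) (q - mpolyC n (meval x q)) ->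
      ideal_span (adj (enum 'I_n) x) (r - mpolyC n (meval x r)) ->
      ideal_span (adj (enum 'I_n) x) (q * r - mpolyC n (meval x (q * r))).
    move=> Hq Hr; rewrite mevalM mpolyCM.
    set q' := mpolyC _ _ in Hq *; set r' := mpolyC _ _ in Hr *.
    have -> : q * r - q' * r' = r * (q - q') + q' * (r - r') by ring.
    by apply: ideal_spanD; apply: ideal_spanM.
  have ev1 : ideal_span (adj (enum 'I_n) x) (1 - mpolyC n (meval x 1)).
    by rewrite meval1 mpolyC1 subrr; apply: ideal_span0.
  rewrite mpolyXE_id; elim/big_ind: _ => // i _.
  elim: (m i) => [|k IHk]; first by rewrite expr0.
  by rewrite exprS; apply: evM => //; rewrite mevalXU.
move=> p Sp; apply/eqP; apply: contrapT => /negP px; apply: xP.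
have -> : 1 = mpolyC n (meval x p)^-1 * (p - (p - mpolyC n (meval x p))).
  by rewrite opprB addrC subrK -mpolyCM mulVf// mpolyC1.
apply: ideal_spanM; apply: ideal_spanB => //.
by apply: ideal_span_gen; left.
Qed.
End Nullstellensatz.

(** * Regular and rational functions omitting uncountably many values *)

Section FiniteValues.
Variable F : closedFieldType.
Hypothesis uF : ~ countable [set: F].

(** For [z] in [E], [f - z] has no zero on the closed set, hence is a unit modulo [S]. A finite
    product of factors [f - z] then lies in the ideal, and its roots are the only possible
    values. *)
Lemma mpoly_finite_values n (S : set (mpoly n F)) (f : mpoly n F) (E : set F) :
  ~ countable E -> (forall x, zeros S x -> ~ E (meval x f)) ->
  exists cs : seq F, forall x, zeros S x -> meval x f \in cs.
Proof.
move=> uE SE; have [|zs zsS] := @ideal_span_prod_sub _ _ S f E uE.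
  move=> z Ez; have [|a] := @ideal_span_adjoin _ S (f - mpolyC n z) 1.
    apply: weak_nullstellensatz => //; apply/seteqP; split=> // x Sx /=.
    have /SE : zeros S x by move=> p Sp; apply: Sx; left.
    apply; have := Sx _ (or_intror erefl).
    by rewrite mevalB mevalC => /subr0_eq ->.
  by exists a; rewrite -[_ - 1]opprB -[X in ideal_span _ X]mulN1r; apply: ideal_spanM.
exists zs => x Sx; have := ideal_span_zeros Sx zsS.
rewrite rmorph_prod /= => /eqP; rewrite prodf_seq_eq0 => /hasP[z zzs /=].
by rewrite mevalB mevalC subr_eq0 => /eqP ->.
Qed.

(* Rabinowitsch's trick: an extra variable t with t * Q = 1. *)
Lemma mpoly_ratio_finite_values n (S : set (mpoly n F)) (P Q : mpoly n F)
    (E : set F) : ~ countable E ->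
  (forall x, zeros S x -> meval x Q != 0 -> ~ E (meval x P / meval x Q)) ->
  exists cs : seq F, forall x, zeros S x -> meval x Q != 0 ->
    meval x P / meval x Q \in cs.
Proof.
move=> uE SE.
(* [up] shifts the variables past [ord_max], which is left free for [t]. *)
pose up (p : mpoly n F) : mpoly n.+1 F :=
  comp_mpoly [tuple mpolyX F (mnm1 (lift ord_max i)) | i < n] p.
have upE x p : meval x (up p) = meval (fun i => x (lift ord_max i)) p.
  rewrite comp_mpoly_meval; apply: meval_eq => i.
  by rewrite tnth_mktuple mevalXU.
pose t : mpoly n.+1 F := mpolyX F (mnm1 ord_max).
pose S' := (up @` S) `|` [set up Q * t - 1].
have S'P x : zeros S' x -> zeros S (fun i => x (lift ord_max i)) /\
    meval (fun i => x (lift ord_max i)) Q * x ord_max = 1.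
  move=> S'x; split=> [p Sp|].
    by rewrite -upE; apply: S'x; left; exists p.
  have := S'x _ (or_intror erefl).
  by rewrite mevalB mevalM meval1 upE mevalXU => /subr0_eq.
have [x S'x|cs csP] := @mpoly_finite_values _ S' (up P * t) E uE.
  have [Sx Qx] := S'P x S'x; rewrite mevalM upE mevalXU.
  have Q0 : meval (fun i => x (lift ord_max i)) Q != 0.
    by apply: contra_eq_neq Qx => ->; rewrite mul0r eq_sym oner_neq0.
  have -> : x ord_max = (meval (fun i => x (lift ord_max i)) Q)^-1.
    by apply: (mulfI Q0); rewrite Qx mulfV.
  exact: SE.
exists cs => x Sx Qx.
pose y (i : 'I_n.+1) := oapp x (meval x Q)^-1 (unlift ord_max i).
have yx : (fun i => y (lift ord_max i)) = x.
  by apply/funext => i; rewrite /y liftK.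
have yt : y ord_max = (meval x Q)^-1 by rewrite /y unlift_none.
have := csP y; rewrite mevalM upE mevalXU yx yt; apply.
move=> p [[q Sq <-]|->]; first by rewrite upE yx; apply: Sx.
by rewrite mevalB mevalM meval1 upE mevalXU yx yt mulfV ?subrr.
Qed.

End FiniteValues.

(** * Polynomial functions of matrices and Zariski-closed sets *)

Section PolynomialFunctions.
Variables (F : fieldType) (n : nat).
Implicit Types f g : 'M[F]_n -> F.

Definition polyfun f := exists p : mpoly (n * n) F,
  forall A, f A = meval (fun k => mxvec A ord0 k) p.

Lemma polyfun_cst c : polyfun (fun=> c).
Proof. by exists (mpolyC _ c) => A; rewrite mevalC. Qed.

Lemma polyfun_coord i j : polyfun (fun A => A i j).
Proof.
exists (mpolyX F (mnm1 (mxvec_index i j))) => A.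
by rewrite mevalXU mxvecE.
Qed.

Lemma polyfunM f g : polyfun f -> polyfun g -> polyfun (fun A => f A * g A).
Proof. by move=> [p fp] [q gq]; exists (p * q) => A; rewrite mevalM fp gq. Qed.

Lemma polyfun_sum (I : Type) (r : seq I) (P : pred I) (f : I -> 'M[F]_n -> F) :
  (forall i, polyfun (f i)) -> polyfun (fun A => \sum_(i <- r | P i) f i A).
Proof.
move=> fP; elim: r => [|i r [p IH]].
  by exists 0 => A; rewrite big_nil meval0.
have [q fq] := fP i; exists (if P i then q + p else p) => A.
by rewrite big_cons; case: ifP => _; rewrite ?mevalD -IH // fq.
Qed.

Lemma polyfun_prod (I : Type) (r : seq I) (P : pred I) (f : I -> 'M[F]_n -> F) :
  (forall i, polyfun (f i)) -> polyfun (fun A => \prod_(i <- r | P i) f i A).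
Proof.
move=> fP; elim: r => [|i r [p IH]].
  by exists 1 => A; rewrite big_nil meval1.
have [q fq] := fP i; exists (if P i then q * p else p) => A.
by rewrite big_cons; case: ifP => _; rewrite ?mevalM -IH // fq.
Qed.

Lemma polyfunX f k : polyfun f -> polyfun (fun A => f A ^+ k).
Proof. by move=> [p fp]; exists (p ^+ k) => A; rewrite rmorphXn /= fp. Qed.

Lemma polyfun_lmx m l (B : 'M[F]_(m, n)) (C : 'M[F]_(n, l)) i j :
  polyfun (fun A => (B *m A *m C) i j).
Proof.
have [p pP] : polyfun (fun A => \sum_b (\sum_a B i a * A a b) * C b j).
  apply: polyfun_sum => b; apply: polyfunM; last exact: polyfun_cst.
  apply: polyfun_sum => a; apply: polyfunM; first exact: polyfun_cst.
  exact: polyfun_coord.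
exists p => A; rewrite -pP mxE; apply: eq_bigr => b _; by rewrite mxE.
Qed.

Lemma polyfun_det m (f : 'M[F]_n -> 'M[F]_m) :
  (forall i j, polyfun (fun A => f A i j)) -> polyfun (fun A => \det (f A)).
Proof.
move=> fP; apply: polyfun_sum => s; apply: polyfunM; first exact: polyfun_cst.
by apply: polyfun_prod => i; apply: fP.
Qed.

Lemma zariski_closed_polyfun (T : set ('M[F]_n -> F)) :
  (forall f, T f -> polyfun f) ->
  zariski_closed [set A | A \in unitmx /\ forall f, T f -> f A = 0].
Proof.
move=> Tpoly.
exists [set p | T (fun A => meval (fun k => mxvec A ord0 k) p)].
apply/seteqP; split=> A [uA AT]; split=> //; first by move=> p /AT.
move=> f Tf; have [p fp] := Tpoly f Tf.
rewrite fp; apply: AT => /=; rewrite (_ : (fun A => _) = f)//.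
by apply/funext.
Qed.

Lemma zariski_closed0 : zariski_closed (set0 : set 'M[F]_n).
Proof.
exists [set 1]; apply/seteqP; split=> // A [_ /(_ 1 erefl)].
by rewrite meval1 => /eqP; rewrite oner_eq0.
Qed.

Lemma zariski_closedU (Z1 Z2 : set 'M[F]_n) :
  zariski_closed Z1 -> zariski_closed Z2 -> zariski_closed (Z1 `|` Z2).
Proof.
move=> [S1 ->] [S2 ->]; exists [set p | exists2 p1, S1 p1 &
  exists2 p2, S2 p2 & p = p1 * p2].
apply/seteqP; split=> A.
  move=> [] [uA AS]; split=> // _ [p1 Sp1 [p2 Sp2 ->]]; rewrite mevalM.
    by rewrite AS// mul0r.
  by rewrite [X in _ * X]AS// mulr0.
move=> [uA AS]; apply: contrapT => /not_orP[] /not_andP[//|].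
move=> /existsNP[p1 /not_implyP[Sp1 /eqP p1A]] /not_andP[//|].
move=> /existsNP[p2 /not_implyP[Sp2 /eqP p2A]].
have /eqP := AS (p1 * p2) (ex_intro2 _ _ p1 Sp1 (ex_intro2 _ _ p2 Sp2 erefl)).
by rewrite mevalM mulf_eq0 (negPf p1A) (negPf p2A).
Qed.

Lemma zariski_closed_bigU (I : eqType) (r : seq I) (Z : I -> set 'M[F]_n) :
  (forall i, i \in r -> zariski_closed (Z i)) ->
  zariski_closed [set A | exists2 i, i \in r & Z i A].
Proof.
elim: r => [|i r IH] Zr.
  rewrite (_ : [set _ | _] = set0); first exact: zariski_closed0.
  by apply/seteqP; split=> // A [].
have -> : [set A | exists2 j, j \in i :: r & Z j A] =
    Z i `|` [set A | exists2 j, j \in r & Z j A].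
  apply/seteqP; split=> A.
    move=> [j]; rewrite inE => /orP[/eqP ->|jr] ZA; first by left.
    by right; exists j.
  move=> [ZA|[j jr ZA]]; first by exists i => //; rewrite mem_head.
  by exists j => //; rewrite inE jr orbT.
apply: zariski_closedU; first by apply: Zr; rewrite mem_head.
by apply: IH => j jr; apply: Zr; rewrite inE jr orbT.
Qed.

End PolynomialFunctions.

(** The equations of [G] may also have singular solutions. Multiplying numerator and denominator by
    the determinant keeps the ratio on [G] and makes the denominator vanish at those solutions. *)
Lemma zariski_closed_ratio_finite (F : closedFieldType) n
    (G : set 'M[F]_n) (f h : 'M[F]_n -> F) (E : set F) :
  ~ countable [set: F] -> zariski_closed G -> polyfun f -> polyfun h ->
  ~ countable E -> (forall A, G A -> h A != 0 -> ~ E (f A / h A)) ->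
  exists cs : seq F, forall A, G A -> h A != 0 -> f A / h A \in cs.
Proof.
move=> uF [S GS] fP hP uE GE.
have detP : polyfun (fun A : 'M[F]_n => \det A).
  by apply: polyfun_det => i j; apply: polyfun_coord.
have [P PE] := polyfunM fP detP; have [Q QE] := polyfunM hP detP.
have simp A : \det A != 0 -> f A * \det A / (h A * \det A) = f A / h A.
  by move=> dA; rewrite -mulf_div divff ?mulr1.
pose mx (x : 'I_(n * n) -> F) : 'M[F]_n := vec_mx (\row_k x k).
have mxx x : (fun k => mxvec (mx x) ord0 k) = x.
  by apply/funext => k; rewrite /mx vec_mxK mxE.
have [x Sx Qx|cs csP] := @mpoly_ratio_finite_values F uF _ S P Q E uE.
  rewrite -[x]mxx -PE -QE in Sx Qx *.
  move: Qx; rewrite mulf_eq0 negb_or => /andP[hx dx]; rewrite simp//.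
  apply: GE => //; rewrite GS; split=> //; by rewrite unitmxE unitfE.
exists cs => A GA hA; have := GA; rewrite {1}GS => -[uA SA].
have dA : \det A != 0 by rewrite -unitfE -unitmxE.
by rewrite -simp// PE QE; apply: csP => //; rewrite -QE mulf_neq0.
Qed.

(** * Finite covers of connected groups by subspaces *)

(** A subspace of largest dimension inside [P] is all of [P], since adjoining a missing vector would
    raise the dimension. *)
Lemma vspace_of_set (K : fieldType) (vT : vectType K) (P : set vT) :
  P 0 -> (forall a u v, P u -> P v -> P (a *: u + v)) ->
  exists U : {vspace vT}, forall v, v \in U <-> P v.
Proof.
move=> P0 PL.
pose Q k := `[< exists U : {vspace vT}, \dim U = k /\ (forall v, v \in U -> P v) >].
have Q0 : exists k, Q k.
  exists 0%N; apply/asboolP; exists 0%VS; split; first exact: dimv0.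
  by move=> v; rewrite memv0 => /eqP ->.
have Qmax k : Q k -> (k <= \dim {:vT})%N.
  by move=> /asboolP[U [<- _]]; apply: dimvS; apply: subvf.
case: (ex_maxnP Q0 Qmax) => k /asboolP[U [dU UP]] maxk.
exists U => v; split=> [/UP//|Pv]; apply: contrapT => /negP vU.
have : Q (\dim (U + <[v]>)%VS).
  apply/asboolP; exists (U + <[v]>)%VS; split=> // w /memv_addP[u uU [x]].
  by move=> /vlineP[a ->] ->; rewrite addrC; apply: PL => //; apply: UP.
move=> /maxk; rewrite -dU leqNgt => /negP; apply.
rewrite ltnNge; apply: contra vU => dUv.
have /eqP <- : (U + <[v]> == U)%VS by rewrite eq_sym eqEdim addvSl.
by rewrite (subvP (addvSr _ _))// memv_line.
Qed.

Lemma polyfun_linear (F : fieldType) n (f : 'M[F]_n -> F) :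
  (forall a A B, f (a *: A + B) = a * f A + f B) -> polyfun f.
Proof.
move=> fL.
have f0 : f 0 = 0.
  by have := fL (-1) 0 0; rewrite scaler0 addr0 mulN1r addNr.
have fD A B : f (A + B) = f A + f B by have := fL 1 A B; rewrite scale1r mul1r.
have fS (I : Type) (r : seq I) (h : I -> 'M[F]_n) :
    f (\sum_(i <- r) h i) = \sum_(i <- r) f (h i) by apply: big_morph.
have [p pP] : polyfun (fun A : 'M[F]_n => \sum_i \sum_j A i j * f (delta_mx i j)).
  apply: polyfun_sum => i; apply: polyfun_sum => j.
  by apply: polyfunM; [apply: polyfun_coord|apply: polyfun_cst].
exists p => A; rewrite -pP [in LHS](matrix_sum_delta A) fS.
apply: eq_bigr => i _; rewrite fS; apply: eq_bigr => j _.
by rewrite -[X in f X]addr0 fL f0 addr0.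
Qed.

Section LinearIrreducibility.
Variables (F : fieldType) (n : nat) (G : set 'M[F]_n).
Hypotheses (G_grp : matrix_group G) (G_conn : zariski_connected G).
Implicit Types (V W : {vspace 'M[F]_n}) (s : seq {vspace 'M[F]_n}).

Definition mx_translate (A : 'M[F]_n) V : {vspace 'M[F]_n} :=
  (linfun (mulmx A : 'M[F]_n -> 'M[F]_n) @: V)%VS.

Lemma mem_mx_translate A V B : B \in V -> A *m B \in mx_translate A V.
Proof. by move=> BV; apply/memv_imgP; exists B => //; rewrite lfunE. Qed.

Lemma mx_translateP A V B :
  reflect (exists2 C, C \in V & B = A *m C) (B \in mx_translate A V).
Proof.
by apply: (iffP memv_imgP) => -[C CV ->]; exists C => //; rewrite lfunE.
Qed.

Lemma mx_translate_sub A V W :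
  (mx_translate A V <= W)%VS <-> forall B, B \in V -> A *m B \in W.
Proof.
split=> [/subvP AVW B BV|AVW]; first exact/AVW/mem_mx_translate.
by apply/subvP => _ /mx_translateP[C CV ->]; apply: AVW.
Qed.

Lemma dim_mx_translate A V : A \in unitmx -> \dim (mx_translate A V) = \dim V.
Proof.
move=> uA; rewrite limg_dim_eq//; apply/eqP; rewrite -subv0; apply/subvP => B.
rewrite memv_cap => /andP[_]; rewrite memv_ker lfunE memv0 /= => /eqP AB.
by rewrite -[B]mul1mx -(mulVmx uA) -mulmxA AB mulmx0.
Qed.

(** The condition says that [A *m B] equals its projection to [W] for each [B] in [V], and each
    entry of the difference is linear in [A]. *)
Lemma zariski_closed_translate_sub V W :
  zariski_closed [set A | A \in unitmx /\ (mx_translate A V <= W)%VS].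
Proof.
pose T := [set f : 'M[F]_n -> F | exists B i j, B \in V /\
  f = fun A => (A *m B - projv W (A *m B)) i j].
rewrite (_ : [set _ | _] = [set A | A \in unitmx /\ forall f, T f -> f A = 0]).
  apply: zariski_closed_polyfun => _ [B [i [j [_ ->]]]].
  apply: polyfun_linear => a A A'.
  by rewrite mulmxDl -scalemxAl linearP /= !mxE; ring.
apply/seteqP; split=> A [uA AVW]; split=> //.
  move=> _ [B [i [j [BV ->]]]]; rewrite projv_id ?subrr ?mxE//.
  exact: (mx_translate_sub A V W).1.
apply/mx_translate_sub => B BV.
have -> : A *m B = projv W (A *m B); last exact: memv_proj.
apply/eqP; rewrite -subr_eq0; apply/eqP/matrixP => i j; rewrite [RHS]mxE.
by apply: (AVW (fun A => (A *m B - projv W (A *m B)) i j)); exists B, i, j.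
Qed.

Definition covers s := forall A, G A -> exists2 V, V \in s & A \in V.

(* G permutes the top-dimensional members of a cover of least dimension having
   the fewest such members; by connectedness it then fixes each of them. *)
Lemma covers_irreducible s : covers s ->
  exists2 V, V \in s & forall A, G A -> A \in V.
Proof.
have [GU G1 GM GV] := G_grp.
pose P D := `[< exists2 s, covers s & all (fun V => \dim V <= D)%N s >].
have P0 : exists D, P D.
  exists (\dim {:'M[F]_n}); apply/asboolP; exists [:: fullv].
    by move=> A _; exists fullv; rewrite ?mem_head ?memvf.
  by rewrite /= leqnn.
case: (ex_minnP P0) => D /asboolP[s1 cs1 ds1] minD.
(* Otherwise the members of dimension below [D] would already cover [G], and [D.-1] would contradict
   minimality; [D] is positive because one of them contains the identity. *)
have big_cover s' : covers s' -> exists A V, [/\ G A, A \in V, V \in s' & (D <= \dim V)%N].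
  move=> cs'; apply: contrapT => nbig.
  pose s2 := [seq V <- s' | (\dim V < D)%N].
  have cs2 : covers s2.
    move=> A GA; have [V Vs AV] := cs' A GA; exists V => //.
    rewrite mem_filter Vs andbT ltnNge; apply/negP => DV.
    by apply: nbig; exists A, V.
  have [V] := cs2 _ G1; rewrite mem_filter => /andP[DV _] _.
  suff /minD : P D.-1 by case: (D) DV => //= k _; rewrite ltnn.
  apply/asboolP; exists s2 => //; apply/allP => W.
  by rewrite mem_filter => /andP[+ _]; case: (D) => // k; rewrite ltnS.
pose top s := undup [seq V <- s | \dim V == D].
pose Q m := `[< exists s, [/\ covers s, all (fun V => \dim V <= D)%N s & size (top s) = m] >].
have Q0 : exists m, Q m by exists (size (top s1)); apply/asboolP; exists s1.
case: (ex_minnP Q0) => m /asboolP[s0 [cs0 /allP ds0 ms0]] minm.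
have inT V : (V \in top s0) = (\dim V == D) && (V \in s0).
  by rewrite mem_undup mem_filter.
have GT A V : G A -> V \in top s0 -> mx_translate A V \in top s0.
  move=> GA; have uA := GU _ GA.
  have uA' : invmx A \in unitmx by rewrite unitmx_inv.
  (* Intersecting the cover with its translate by the inverse of [A] gives a cover whose members of
     dimension [D] are both top members and translates of top members. Minimality of [m] forces
     every top member to be of this kind. *)
  pose s2 := [seq (V1 :&: mx_translate (invmx A) V2)%VS | V1 <- s0, V2 <- s0].
  have cs2 : covers s2.
    move=> B GB; have [V1 V1s BV1] := cs0 B GB.
    have [V2 V2s BV2] := cs0 (A *m B) (GM _ _ GA GB).
    exists (V1 :&: mx_translate (invmx A) V2)%VS.
      by apply/allpairsP; exists (V1, V2).
    rewrite memv_cap BV1 /=; apply/mx_translateP; exists (A *m B) => //.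
    by rewrite mulKmx.
  have ds2 W : W \in s2 -> (\dim W <= D)%N.
    move=> /allpairsP[[V1 V2] /= [/ds0 dV1 _ ->]].
    by apply: leq_trans dV1; apply: dimvS; apply: capvSl.
  have eqV V1 V2 : V1 \in s0 -> V2 \in s0 ->
      \dim (V1 :&: mx_translate (invmx A) V2) = D ->
      [/\ V1 \in top s0, V2 \in top s0 & V1 = mx_translate (invmx A) V2].
    move=> /[dup] /ds0 dV1 V1s /[dup] /ds0 dV2 V2s dI.
    have eq1 : (V1 :&: mx_translate (invmx A) V2)%VS = V1.
      by apply/eqP; rewrite eqEdim capvSl dI.
    have eq2 : (V1 :&: mx_translate (invmx A) V2)%VS = mx_translate (invmx A) V2.
      by apply/eqP; rewrite eqEdim capvSr dI dim_mx_translate.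
    have dV2' : \dim V2 = D by rewrite -(dim_mx_translate V2 uA') -eq2.
    by rewrite !inT V1s V2s dV2' -{1}eq1 dI eqxx; split=> //; rewrite -{1}eq1.
  have sub : {subset top s2 <= top s0}.
    move=> W; rewrite mem_undup mem_filter => /andP[/eqP dW].
    move=> /allpairsP[[V1 V2] /= [V1s V2s WE]]; rewrite WE in dW *.
    by have [V1T _ V1E] := eqV _ _ V1s V2s dW; rewrite -V1E capvv.
  have sz : (size (top s0) <= size (top s2))%N.
    by rewrite ms0; apply: minm; apply/asboolP; exists s2; split=> //; apply/allP.
  have [_ Teq] := uniq_min_size (undup_uniq _) sub sz.
  rewrite -Teq mem_undup mem_filter => /andP[/eqP dV].
  move=> /allpairsP[[V1 V2] /= [V1s V2s VE]]; rewrite VE in dV *.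
  have [_ V2T V1E] := eqV _ _ V1s V2s dV; rewrite -V1E capvv V1E.
  rewrite (_ : mx_translate A _ = V2)//; apply/eqP.
  rewrite eqEdim !dim_mx_translate// leqnn andbT.
  apply/mx_translate_sub => _ /mx_translateP[C CV ->].
  by rewrite mulmxA mulmxV// mul1mx.
have [A0 [V [GA0 A0V Vs0 DV]]] := big_cover _ cs0.
have VT : V \in top s0 by rewrite inT Vs0 eqn_leq DV ds0.
have VG A : G A -> (mx_translate A V <= V)%VS.
  (* As top members have equal dimension, the sets [Z W] are disjoint for distinct [W]. They are
     closed and cover [G], and [Z V] contains the identity. *)
  pose Z W := [set A | A \in unitmx /\ (mx_translate A V <= W)%VS].
  pose Z2 := [set A | exists2 W, W \in rem V (top s0) & Z W A].
  have ZT : G `<=` Z V `|` Z2.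
    move=> B GB; have := GT B V GB VT.
    have [BV _|BV BT] := eqVneq (mx_translate B V) V.
      by left; split; [apply: GU|rewrite BV].
    right; exists (mx_translate B V); last by split; [apply: GU|].
    by rewrite mem_rem_uniq ?undup_uniq// inE BV BT.
  have Z0 : G `&` Z V `&` Z2 = set0.
    apply/seteqP; split=> // B [[GB [uB BV]]] [W]; rewrite mem_rem_uniq ?undup_uniq//.
    rewrite inE => /andP[/eqP WV WT] [_ BW]; apply: WV.
    move: VT WT; rewrite !inT => /andP[/eqP dV _] /andP[/eqP dW _].
    have e1 : mx_translate B V = V by apply/eqP; rewrite eqEdim BV dim_mx_translate ?leqnn.
    by apply/esym/eqP; rewrite eqEdim -{1}e1 BW dV dW leqnn.
  have Z1cl : zariski_closed (Z V) by apply: zariski_closed_translate_sub.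
  have Z2cl : zariski_closed Z2.
    by apply: zariski_closed_bigU => W _; apply: zariski_closed_translate_sub.
  have [e0|e0] := G_conn Z1cl Z2cl ZT Z0.
  - suff : (G `&` Z V) 1%:M by rewrite e0.
    split=> //; split; first exact: unitmx1.
    by apply/mx_translate_sub => B; rewrite mul1mx.
  - move=> GA; have [[_ //]|Z2A] := ZT _ GA.
    suff : (G `&` Z2) A by rewrite e0.
    by split.
(* [V] contains [A0] and is stable under [A *m invmx A0], so it contains [A]. *)
have GsubV A : G A -> A \in V.
  move=> GA; have /(_ A0 A0V) := (mx_translate_sub _ V V).1 (VG _ (GM _ _ GA (GV _ GA0))).
  by rewrite -mulmxA mulVmx ?mulmx1//; apply: GU.
(* Traces on [V] of the members of any cover form a cover, so one of them has dimension at least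
   [D], that of [V]. *)
move=> cs; have [|B [W [GB BW /mapP[L Ls WE] DW]]] := big_cover [seq (V :&: L)%VS | L <- s].
  move=> A GA; have [L Ls AL] := cs A GA; exists (V :&: L)%VS.
    exact: map_f.
  by rewrite memv_cap AL GsubV.
exists L => // A /GsubV AV; suff VL : (V <= L)%VS by apply: (subvP VL).
have /eqP <- : (V :&: L)%VS == V.
  by rewrite eqEdim capvSl -WE (leq_trans _ DW)//; apply: ds0.
exact: capvSr.
Qed.

End LinearIrreducibility.

Lemma mx11_eq0 (F : pzRingType) (A : 'M[F]_1) : (A == 0) = (A 0 0 == 0).
Proof.
apply/eqP/eqP => [->|A0]; first by rewrite mxE.
by apply/matrixP => i j; rewrite !ord1 A0 mxE.
Qed.

(** [Q] is the matrix of the identity minus the projection to [W]. *)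
Lemma vspace_kernel_mx (F : fieldType) m (W : {vspace 'cV[F]_m}) :
  exists Q : 'M[F]_m, forall x, (x \in W) = (Q *m x == 0).
Proof.
pose Q : 'M[F]_m := \matrix_(i, j) (delta_mx j 0 - projv W (delta_mx j 0)) i 0.
have QE x : Q *m x = x - projv W x.
  rewrite [in RHS](matrix_sum_delta x) linear_sum -sumrB.
  apply/matrixP => i k; rewrite ord1 mxE summxE; apply: eq_bigr => j _.
  by rewrite big_ord1 linearZ -scalerBr !mxE mulrC.
exists Q => x; rewrite QE subr_eq0; apply/idP/eqP => [/projv_id ->//|->].
exact: memv_proj.
Qed.

Lemma annihilator_neq0 (F : fieldType) m (W : {vspace 'cV[F]_m}) :
  W != fullv -> exists2 phi : 'rV[F]_m, phi != 0 & forall x, x \in W -> phi *m x = 0.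
Proof.
have [Q QW] := vspace_kernel_mx W; move=> Wn.
have [k Qk] : exists k, row k Q != 0.
  apply: contrapT => /forallNP Q0; case/eqP: Wn; apply/vspaceP => x.
  rewrite memvf QW; apply/eqP/row_matrixP => k; rewrite row_mul row0.
  by have /negP/negPn/eqP -> := Q0 k; rewrite mul0mx.
exists (row k Q) => // x; rewrite QW -row_mul => /eqP ->.
by rewrite row0.
Qed.

(** * Simultaneous nonvanishing of matrix coefficients *)

Section IrreduciblePairs.
Variables (F : fieldType) (n : nat) (G : set 'M[F]_n).
Hypotheses (G_grp : matrix_group G) (G_conn : zariski_connected G)
  (G_irr : irreducible_action G).

(** The vectors [u] with [rho *m A *m u = 0] for all [A] in [G] form an invariant subspace, proper
    because [rho] is nonzero; hence it is zero and misses [v]. *)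
Lemma irreducible_pair (rho : 'rV[F]_n) (v : 'cV[F]_n) :
  rho != 0 -> v != 0 -> exists2 A, G A & rho *m A *m v != 0.
Proof.
have [_ G1 GM _] := G_grp; have [_ irr] := G_irr.
move=> rho0 v0; apply: contrapT => nA.
have {}nA A : G A -> rho *m A *m v = 0.
  by move=> GA; apply: contrapT => /eqP Av; apply: nA; exists A.
have [|a u w Hu Hw|U UP] := @vspace_of_set _ _
  [set u : 'cV[F]_n | forall A, G A -> rho *m A *m u = 0].
- by move=> A _; rewrite mulmx0.
- by move=> A GA; rewrite mulmxDr -scalemxAr Hu// Hw// scaler0 addr0.
have [|U0|Uf] := irr U.
- move=> A GA; apply/subvP => _ /memv_imgP[u uU ->]; rewrite lfunE /=.
  apply/UP => B GB; rewrite mulmxA -(mulmxA rho); apply: (UP u).1 => //.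
  exact: GM.
- have : v \in U by apply/UP.
  by rewrite U0 memv0 (negPf v0).
have [j rj] : exists j, rho 0 j != 0 by apply/rV0Pn.
have : (delta_mx j 0 : 'cV[F]_n) \in U by rewrite Uf memvf.
move=> /UP/(_ _ G1); rewrite mulmx1 -colE => /matrixP/(_ 0 0).
by rewrite !mxE => /eqP; rewrite (negPf rj).
Qed.

(** If every [A] failed for some pair, the subspaces where one coefficient vanishes would cover [G].
    One of them would contain [G], against the case of a single pair. *)
Lemma irreducible_pairs (s : seq ('rV[F]_n * 'cV[F]_n)) :
  (forall p, p \in s -> p.1 != 0 /\ p.2 != 0) ->
  exists2 A, G A & forall p, p \in s -> p.1 *m A *m p.2 != 0.
Proof.
move=> s0; apply: contrapT => nA.
have [L LP] : exists L : 'rV[F]_n * 'cV[F]_n -> {vspace 'M[F]_n},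
    forall p A, A \in L p <-> p.1 *m A *m p.2 = 0.
  suff /choice[L LP] : forall p : 'rV[F]_n * 'cV[F]_n, exists L : {vspace 'M[F]_n},
      forall A, A \in L <-> p.1 *m A *m p.2 = 0 by exists L.
  move=> p; apply: (@vspace_of_set _ _ [set A | p.1 *m A *m p.2 = 0]) => /=.
    by rewrite mulmx0 mul0mx.
  move=> a u w Hu Hw.
  by rewrite mulmxDr mulmxDl -scalemxAr -scalemxAl Hu Hw scaler0 addr0.
have [|_ /mapP[p ps ->] GL] := @covers_irreducible _ _ _ G_grp G_conn (map L s).
  move=> A GA; apply: contrapT => nL; apply: nA; exists A => // p ps.
  apply/eqP => pA; apply: nL; exists (L p); first exact: map_f.
  exact/LP.
have [p1 p2] := s0 p ps; have [A GA /eqP] := irreducible_pair p1 p2.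
by apply; apply/LP; apply: GL.
Qed.

End IrreduciblePairs.

(** * Uncountable sets of complex numbers and the squared modulus *)

Section ComplexCountability.
Variable R : realType.

(** Countable sets are Lebesgue null, while the unit segment has measure one. *)
Lemma uncountable_segment (E : set R[i]) (u : R -> R[i]) :
  injective u -> (forall t, 0 <= t <= 1 -> E (u t)) -> ~ countable E.
Proof.
move=> uI uE /countable_injP[f fI].
suff : countable `[0 : R, 1]%classic.
  move=> /countable_lebesgue_measure0; rewrite lebesgue_measure_itv /= lte01.
  by rewrite oppr0 adde0 => /eqP; rewrite onee_eq0.
apply/countable_injP; exists (f \o u) => x y.
rewrite !in_setE /= !in_itv /= => x01 y01 fxy; apply: uI; apply: fI => //;
  by rewrite in_setE; apply: uE.
Qed.

Lemma uncountable_complex : ~ countable [set: R[i]].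
Proof. by apply: (@uncountable_segment _ (real_complex R)) => // x y []. Qed.

Lemma uncountable_nonreal : ~ countable [set z : R[i] | complex.Im z != 0].
Proof.
apply: (@uncountable_segment _ (fun t => Complex 0 (1 + t))) => [x y []|t /andP[t0 _]].
  by move=> /addrI.
by rewrite /= gt_eqF// ltr_pwDl.
Qed.

Definition sqnormc (z : R[i]) : R := complex.Re z ^+ 2 + complex.Im z ^+ 2.

Lemma sqnormcM z w : sqnormc (z * w) = sqnormc z * sqnormc w.
Proof. by case: z w => a b [c e]; rewrite /sqnormc /=; ring. Qed.

Lemma sqnormc0 : sqnormc 0 = 0.
Proof. by rewrite /sqnormc /= expr0n /= addr0. Qed.

Lemma sqnormc1 : sqnormc 1 = 1.
Proof. by rewrite /sqnormc /= expr0n /= addr0 expr1n. Qed.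

Lemma sqnormc_ge0 z : 0 <= sqnormc z.
Proof. by rewrite addr_ge0// sqr_ge0. Qed.

Lemma sqnormc_eq0 z : (sqnormc z == 0) = (z == 0).
Proof.
by case: z => a b; rewrite /sqnormc paddr_eq0 ?sqr_ge0// !sqrf_eq0 eq_complex.
Qed.

Lemma sqnormcX z k : sqnormc (z ^+ k) = sqnormc z ^+ k.
Proof.
by elim: k => [|k IH]; rewrite ?expr0 ?sqnormc1// !exprS sqnormcM IH.
Qed.

Lemma sqnormcV z : sqnormc z^-1 = (sqnormc z)^-1.
Proof.
have [->|z0] := eqVneq z 0; first by rewrite invr0 sqnormc0 invr0.
have s0 : sqnormc z != 0 by rewrite sqnormc_eq0.
by apply: (mulfI s0); rewrite -sqnormcM !divff// sqnormc1.
Qed.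

Lemma uncountable_large c : 0 <= c -> ~ countable [set z : R[i] | c < sqnormc z].
Proof.
move=> c0; apply: (@uncountable_segment _ (fun t => Complex (1 + c + t) 0))
  => [x y []|t /andP[t0 _]].
  by move=> /addrI.
rewrite /= /sqnormc /= expr0n /= addr0; nra.
Qed.

End ComplexCountability.

(** * Realification of complex matrices: products, rank, determinant *)

Section Realification.
Variable R : realType.
Local Notation C := R[i].

Definition re_mx m n (A : 'M[C]_(m, n)) : 'M[R]_(m, n) := map_mx (@complex.Re R) A.
Definition im_mx m n (A : 'M[C]_(m, n)) : 'M[R]_(m, n) := map_mx (@complex.Im R) A.

(** The rectangular form of [realify], so that rank factorizations can be realified factor by
    factor. *)
Definition crealify m n (A : 'M[C]_(m, n)) : 'M[R]_(m + m, n + n) :=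
  block_mx (re_mx A) (- im_mx A) (im_mx A) (re_mx A).

Definition realvec m n (A : 'M[C]_(m, n)) : 'M[R]_(m + m, n) :=
  col_mx (re_mx A) (im_mx A).

Lemma crealifyE d (A : 'M[C]_d) : realify A = crealify A. Proof. by []. Qed.

Lemma complexReD (x y : C) : complex.Re (x + y) = complex.Re x + complex.Re y.
Proof. by case: x y => ? ? []. Qed.
Lemma complexImD (x y : C) : complex.Im (x + y) = complex.Im x + complex.Im y.
Proof. by case: x y => ? ? []. Qed.
Lemma complexReM (x y : C) : complex.Re (x * y) =
  complex.Re x * complex.Re y - complex.Im x * complex.Im y.
Proof. by case: x y => ? ? []. Qed.
Lemma complexImM (x y : C) : complex.Im (x * y) =
  complex.Re x * complex.Im y + complex.Im x * complex.Re y.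
Proof. by case: x y => ? ? []. Qed.

Lemma re_mxM m n p (A : 'M[C]_(m, n)) (B : 'M[C]_(n, p)) :
  re_mx (A *m B) = re_mx A *m re_mx B - im_mx A *m im_mx B.
Proof.
apply/matrixP => i j; rewrite !mxE (big_morph _ complexReD (erefl _)) -sumrB.
by apply: eq_bigr => k _; rewrite !mxE complexReM.
Qed.

Lemma im_mxM m n p (A : 'M[C]_(m, n)) (B : 'M[C]_(n, p)) :
  im_mx (A *m B) = re_mx A *m im_mx B + im_mx A *m re_mx B.
Proof.
apply/matrixP => i j; rewrite !mxE (big_morph _ complexImD (erefl _)) -big_split /=.
by apply: eq_bigr => k _; rewrite !mxE complexImM.
Qed.

Lemma crealifyM m n p (A : 'M[C]_(m, n)) (B : 'M[C]_(n, p)) :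
  crealify (A *m B) = crealify A *m crealify B.
Proof.
rewrite /crealify mulmx_block re_mxM im_mxM !mulmxN !mulNmx opprD.
by congr block_mx; rewrite addrC.
Qed.

Lemma crealify_realvec m n p (A : 'M[C]_(m, n)) (B : 'M[C]_(n, p)) :
  crealify A *m realvec B = realvec (A *m B).
Proof.
rewrite /crealify /realvec mul_block_col re_mxM im_mxM !mulNmx.
by congr col_mx; rewrite addrC.
Qed.

Lemma crealify1 n : crealify (1%:M : 'M[C]_n) = 1%:M.
Proof.
rewrite /crealify [RHS](scalar_mx_block n n).
have -> : re_mx (1%:M : 'M[C]_n) = 1%:M.
  by apply/matrixP => i j; rewrite !mxE; case: (i == j).
have -> : im_mx (1%:M : 'M[C]_n) = 0.
  by apply/matrixP => i j; rewrite !mxE; case: (i == j).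
by rewrite oppr0.
Qed.

Lemma crealify_inj m n : injective (@crealify m n).
Proof.
move=> A B /eq_block_mx[/matrixP reE _ /matrixP imE _]; apply/matrixP => i j.
have := reE i j; have := imE i j; rewrite !mxE.
by case: (A i j) (B i j) => ? ? [? ?] /= -> ->.
Qed.

Lemma crealify0 m n : crealify (0 : 'M[C]_(m, n)) = 0.
Proof.
rewrite /crealify (_ : re_mx _ = 0) 1?(_ : im_mx _ = 0) ?oppr0 ?block_mx0//.
  by apply/matrixP => i j; rewrite !mxE.
by apply/matrixP => i j; rewrite !mxE.
Qed.

Lemma crealifyZ m n (l : R) (A : 'M[C]_(m, n)) :
  crealify (real_complex R l *: A) = l *: crealify A.
Proof.
rewrite /crealify scale_block_mx; congr block_mx; apply/matrixP => i j;
  by rewrite !mxE ?complexReM ?complexImM /= ?mul0r ?subr0 ?addr0 ?mulrN.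
Qed.

Lemma realvec_surj m n (x : 'M[R]_(m + m, n)) : exists A, x = realvec A.
Proof.
exists (\matrix_(i, j) Complex (usubmx x i j) (dsubmx x i j)).
rewrite -[LHS]vsubmxK; congr col_mx; by apply/matrixP => i j; rewrite !mxE.
Qed.

Lemma realvec_eq0 m n (A : 'M[C]_(m, n)) : (realvec A == 0) = (A == 0).
Proof.
apply/eqP/eqP => [|->]; last first.
  rewrite /realvec (_ : re_mx _ = 0) 1?(_ : im_mx _ = 0) ?col_mx0//;
  by apply/matrixP => i j; rewrite !mxE.
rewrite -col_mx0 => /eq_col_mx[/matrixP re0 /matrixP im0]; apply/matrixP => i j.
have := re0 i j; have := im0 i j; rewrite !mxE.
by case: (A i j) => a b /= -> ->.
Qed.

(** The rank factorization of [A] realifies to one of inner size twice the rank, and the one-sided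
    inverses [E] and [D] of its factors show that the bound is attained. *)
Lemma rank_crealify m n (A : 'M[C]_(m, n)) :
  \rank (crealify A) = (\rank A + \rank A)%N.
Proof.
have [E EB] := row_fullP (col_base_full A).
have [D BD] := row_freeP (row_base_free A).
apply/eqP; rewrite eqn_leq; apply/andP; split.
  by rewrite -{1}(mulmx_base A) crealifyM mulmx_max_rank.
have e : crealify E *m crealify A *m crealify D = 1%:M.
  rewrite -!crealifyM -crealify1 -[X in _ *m X *m _](mulmx_base A).
  by congr crealify; rewrite mulmxA EB mul1mx BD.
rewrite -{1}(mxrank1 R (\rank A + \rank A)) -e.
by rewrite (leq_trans (mxrankM_maxl _ _))// mxrankM_maxr.
Qed.

(** Over the complex numbers, conjugation by a unipotent block matrix ([L] and its inverse [U])
    makes the realification block triangular, with diagonal blocks [A] and its conjugate. *)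
Lemma det_crealify n (A : 'M[C]_n) : \det (crealify A) = sqnormc (\det A).
Proof.
have reE : map_mx (real_complex R) (re_mx A) + 'i%C *: map_mx (real_complex R) (im_mx A) = A.
  by apply/matrixP => i j; rewrite !mxE [RHS]complexE.
have imE : map_mx (real_complex R) (re_mx A) - 'i%C *: map_mx (real_complex R) (im_mx A) =
    map_mx (@conjc R) A.
  apply/matrixP => i j; rewrite !mxE; case: (A i j) => a b.
  apply/eqP; rewrite eq_complex /=; apply/andP; split; apply/eqP; ring.
set a := map_mx _ (re_mx A) in reE imE; set b := map_mx _ (im_mx A) in reE imE.
have i2 : 'i%C * 'i%C = -1 :> C by rewrite -expr2 sqr_i.
apply: (@complexI R); rewrite -det_map_mx map_block_mx map_mxN -/a -/b.
pose L : 'M[C]_(n + n) := block_mx 1%:M 0 ('i%C)%:M 1%:M.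
pose U : 'M[C]_(n + n) := block_mx 1%:M 0 (- 'i%C)%:M 1%:M.
have dL : \det L = 1 by rewrite det_lblock !det1 mulr1.
have dU : \det U = 1 by rewrite det_lblock !det1 mulr1.
rewrite -[LHS]mul1r -{1}dL -[LHS]mulr1 -dU -!det_mulmx.
have -> : L *m block_mx a (- b) b a *m U = block_mx A (- b) 0 (map_mx (@conjc R) A).
  rewrite !mulmx_block !mul1mx !mul0mx !mulmx1 !mulmx0 !addr0 !add0r.
  rewrite !mul_scalar_mx !mul_mx_scalar.
  have e1 : a + - 'i%C *: - b = A by rewrite scalerN scaleNr opprK reE.
  have e2 : 'i%C *: - b + a = map_mx (@conjc R) A by rewrite scalerN addrC imE.
  have e3 : 'i%C *: a + b + - 'i%C *: ('i%C *: - b + a) = 0.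
    rewrite scalerDr scalerA mulNr i2 opprK scale1r scaleNr.
    by rewrite [X in _ + X]addrC addrACA !subrr addr0.
  by rewrite e1 e3 e2.
rewrite det_ublock (det_map_mx (@conjc R)); move: (\det A) => [x y].
apply/eqP; rewrite eq_complex /sqnormc /=.
by apply/andP; split; apply/eqP; ring.
Qed.

End Realification.

(** * The closed cone spanned by a group *)

Section MatrixTopology.
Variable R : realType.

Lemma mx_continuous (T : topologicalType) m n (f : T -> 'M[R]_(m, n)) :
  (forall i j, continuous (fun x => f x i j)) -> continuous f.
Proof.
move=> cf x; apply/cvg_ballP => e e0.
have : \forall y \near x, forall i, forall j, ball (f x i j) e (f y i j).
  apply: filter_forall => i; apply: filter_forall => j.
  by have /cvg_ballP := cf i j x; apply.
by apply: filterS => y; split.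
Qed.

Lemma continuous_sumr (T : topologicalType) (I : Type) (r : seq I) (P : pred I)
    (f : I -> T -> R) : (forall i, continuous (f i)) ->
  continuous (fun x => \sum_(i <- r | P i) f i x).
Proof.
move=> cf; elim: r => [|i r IH].
  by under eq_fun do rewrite big_nil; apply: cst_continuous.
under eq_fun do rewrite big_cons.
case: (P i) => // x; apply: continuousD; [exact: cf|exact: IH].
Qed.

Lemma continuous_prodr (T : topologicalType) (I : Type) (r : seq I) (P : pred I)
    (f : I -> T -> R) : (forall i, continuous (f i)) ->
  continuous (fun x => \prod_(i <- r | P i) f i x).
Proof.
move=> cf; elim: r => [|i r IH].
  by under eq_fun do rewrite big_nil; apply: cst_continuous.
under eq_fun do rewrite big_cons.
case: (P i) => // x; apply: continuousM; [exact: cf|exact: IH].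
Qed.

Lemma mulmx_lr_continuous m n p q (A : 'M[R]_(p, m)) (B : 'M[R]_(n, q)) :
  continuous (fun M : 'M[R]_(m, n) => A *m M *m B).
Proof.
apply: mx_continuous => i j.
have -> : (fun M : 'M[R]_(m, n) => (A *m M *m B) i j) =
    (fun M => \sum_b (\sum_a A i a * M a b) * B b j).
  by apply/funext => M; rewrite mxE; apply: eq_bigr => b _; rewrite mxE.
apply: continuous_sumr => b x; apply: continuousM; last exact: cst_continuous.
apply: continuous_sumr => a y; apply: continuousM; first exact: cst_continuous.
exact: coord_continuous.
Qed.

Lemma det_continuous n : continuous (fun M : 'M[R]_n => \det M).
Proof.
apply: continuous_sumr => s x.
have cs : {for x, continuous ((fun=> (-1) ^+ perm.odd_perm s : R) : 'M[R]_n -> R)}.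
  exact: cst_continuous.
have cp : {for x, continuous (fun M : 'M[R]_n => \prod_i M i (perm.fun_of_perm s i))}.
  by apply: continuous_prodr => i; apply: coord_continuous.
exact: (continuousM cs cp).
Qed.

Lemma closed_preimage (T U : topologicalType) (f : T -> U) (Z : set U) :
  continuous f -> closed Z -> closed (f @^-1` Z).
Proof. by move=> /continuous_closedP; apply. Qed.

Lemma closed_mx0 (T : topologicalType) m n (f : T -> 'M[R]_(m, n)) :
  continuous f -> closed [set x | f x = 0].
Proof.
move=> cf; have -> : [set x | f x = 0] =
    \bigcap_(ij in [set: 'I_m * 'I_n]) ((fun x => f x ij.1 ij.2) @^-1` [set 0]).
  apply/seteqP; split=> x /=; first by move=> fx ij _ /=; rewrite fx mxE.
  by move=> fx; apply/matrixP => i j; rewrite mxE; apply: (fx (i, j)).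
apply: closed_bigI => ij _; apply: closed_preimage; last exact: closed_eq.
move=> x; apply: (@continuous_comp _ _ _ f (fun M : 'M[R]_(m, n) => M ij.1 ij.2)).
  exact: cf.
exact: coord_continuous.
Qed.

Lemma normr_mx_entry m n (M : 'M[R]_(m, n)) i j : `|M i j| <= `|M|.
Proof.
have /mapP[k Hk ->] : `|M i j| \in [seq `|M x.1 x.2| | x : 'I_m * 'I_n].
  by apply/mapP; exists (i, j) => //=; rewrite mem_enum.
by rewrite [leRHS]/Num.norm /= mx_normrE; apply/bigmax_geP; right => /=; exists k.
Qed.

Lemma sphere_min m n (T : set 'M[R]_(m, n)) (f : 'M[R]_(m, n) -> R) :
  closed T -> (forall M, T M -> `|M| = 1) -> continuous f ->
  (forall M, T M -> 0 < f M) -> exists2 c, 0 < c & forall M, T M -> c <= f M.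
Proof.
move=> clT T1 cf fT.
have [T0|/set0P[M0 TM0]] := eqVneq T set0.
  by exists 1 => // M; rewrite T0.
have cvec : continuous (vec_mx : 'rV[R]_(m * n) -> 'M[R]_(m, n)).
  apply: mx_continuous => i j; under eq_fun do rewrite mxE.
  exact: coord_continuous.
(* Flattened to row vectors, [T] is a closed subset of a product of segments. *)
pose T' := (vec_mx : 'rV[R]_(m * n) -> 'M[R]_(m, n)) @^-1` T.
have cT' : compact T'.
  apply: (@subclosed_compact _ _
    [set v : 'rV[R]_(m * n) | forall i, `[(-1), 1]%classic (v ord0 i)]).
  - exact: closed_preimage.
  - by apply: (@rV_compact R (m * n) (fun=> `[(-1 : R), 1]%classic)) => _; apply: segment_compact.
  - move=> v Tv i; rewrite /= in_itv /= -ler_norml -(T1 _ Tv).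
    case/mxvec_indexP: i => a b; have := normr_mx_entry (vec_mx v) a b.
    by rewrite [X in `|X| <= _ -> _]mxE.
have [|||v] := @EVT_min_rV R _ (f \o vec_mx) T'.
- by exists (mxvec M0); rewrite /T' /= mxvecK.
- exact: cT'.
- apply: continuous_subspaceT => x; apply: continuous_comp; first exact: cvec.
  exact: cf.
rewrite in_setE => T'v minv; exists (f (vec_mx v)); first exact: fT.
move=> M TM; have := minv (mxvec M); rewrite /= mxvecK; apply.
by rewrite in_setE /T' /= mxvecK.
Qed.

Section ClosedCone.
Variables (m : nat) (Gamma : set 'M[R]_m).
Local Notation K := (closed_cone Gamma).

Lemma closed_cone_closed : closed K.
Proof. exact: closed_closure. Qed.

Lemma closed_coneZ_gen l g : Gamma g -> K (l *: g).
Proof. by move=> Gg; apply: subset_closure; exists l, g. Qed.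

(** The induction principle for the cone: a closed condition need only be checked on real multiples
    of elements of [Gamma]. *)
Lemma closed_cone_sub (Z : set 'M[R]_m) : closed Z ->
  (forall l g, Gamma g -> Z (l *: g)) -> K `<=` Z.
Proof.
move=> clZ GZ; rewrite [Z](closure_id Z).1//; apply: closureS.
by move=> _ [l [g [Gg ->]]]; apply: GZ.
Qed.

Lemma closed_coneZ l M : K M -> K (l *: M).
Proof.
move: M; apply: (@closed_cone_sub (( *:%R l) @^-1` K)).
  apply: closed_preimage; last exact: closed_cone_closed.
  exact: scaler_continuous.
by move=> a g Gg; rewrite /= scalerA; apply: closed_coneZ_gen.
Qed.

Hypothesis GammaM : forall g h, Gamma g -> Gamma h -> Gamma (g *m h).

(** The closure is passed one factor at a time: first on the right for a fixed element of [Gamma],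
    then on the left for a fixed element of the cone. *)
Lemma closed_coneM M N : K M -> K N -> K (M *m N).
Proof.
have KM g P : Gamma g -> K P -> K (g *m P).
  move=> Gg; move: P; apply: (@closed_cone_sub ((mulmx g) @^-1` K)).
    apply: closed_preimage; last exact: closed_cone_closed.
    rewrite (_ : mulmx g = fun M => g *m M *m 1%:M); first exact: mulmx_lr_continuous.
    by apply/funext => P; rewrite mulmx1.
  by move=> a h Gh; rewrite /= -scalemxAr; apply: closed_coneZ_gen; apply: GammaM.
move=> + KN; move: M; apply: (@closed_cone_sub ((mulmxr N) @^-1` K)).
  apply: closed_preimage; last exact: closed_cone_closed.
  rewrite (_ : mulmxr N = fun M => 1%:M *m M *m N); first exact: mulmx_lr_continuous.
  by apply/funext => P; rewrite mul1mx.
by move=> l g Gg; rewrite /= -scalemxAl; apply: closed_coneZ; apply: KM.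
Qed.

End ClosedCone.

(** Complex linearity is closed: it asks for equal diagonal blocks and opposite off-diagonal
    blocks. *)
Lemma closed_cone_realify d (G : set 'M[R[i]]_d) (M : 'M[R]_(d + d)) :
  closed_cone (real_points G) M -> exists A, M = realify A.
Proof.
move: M; apply: (@closed_cone_sub _ _ [set M | exists A, M = realify A]); last first.
  by move=> l _ [A GA <-]; exists (real_complex R l *: A); rewrite !crealifyE crealifyZ.
rewrite (_ : [set _ | _] = [set M : 'M[R]_(d + d) | ulsubmx M - drsubmx M = 0] `&`
   [set M : 'M[R]_(d + d) | ursubmx M + dlsubmx M = 0]).
  apply: closedI; apply: closed_mx0; apply: mx_continuous => i j;
    under eq_fun do rewrite !mxE; move=> x.
    by apply: continuousB; apply: coord_continuous.
  by apply: continuousD; apply: coord_continuous.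
apply/seteqP; split=> M /=.
  move=> [A ->]; rewrite /realify block_mxKul block_mxKdr block_mxKur block_mxKdl.
  by rewrite subrr addNr.
move=> [/subr0_eq e1 /addr0_eq e2].
exists (\matrix_(i, j) Complex (ulsubmx M i j) (dlsubmx M i j)).
rewrite -[LHS]submxK -e1 -[ursubmx M]opprK e2 /realify.
by congr block_mx; apply/matrixP => i j; rewrite !mxE.
Qed.

End MatrixTopology.

(** * Elements of minimal rank *)

Lemma ratio_cancel (F : fieldType) (x y p t : F) : y != 0 -> p != 0 -> t != 0 ->
  x / y = x * p / t / (y * p / t).
Proof. by move=> y0 p0 t0; field; rewrite ?y0 ?p0 ?t0. Qed.

Section RankOne.
Variables (R : realType) (d : nat) (G : set 'M[R[i]]_d).
Hypotheses (G_alg : algebraic_group G) (G_conn : zariski_connected G)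
  (G_irr : irreducible_action G).
Local Notation C := R[i].
Local Notation K := (closed_cone (real_points G)).

Lemma real_pointsM g h : real_points G g -> real_points G h ->
  real_points G (g *m h).
Proof.
have [[_ _ GM _] _] := G_alg.
move=> [A GA <-] [B GB <-]; exists (A *m B); first exact: GM.
by rewrite !crealifyE crealifyM.
Qed.

Lemma closed_cone_group A : G A -> K (realify A).
Proof.
move=> GA; rewrite -[realify A]scale1r; apply: closed_coneZ_gen.
by exists A.
Qed.

(** The matrix norm is the largest absolute value of an entry, and both parts of [h i j] are entries
    of [crealify h]; hence the factor 2. *)
Lemma sqnormc_entry_le m (h : 'M[C]_m) i j :
  sqnormc (h i j) <= 2 * `|crealify h| ^+ 2.
Proof.
have e i' j' : (crealify h i' j') ^+ 2 <= `|crealify h| ^+ 2.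
  by rewrite -real_normK ?num_real// lerXn2r ?nnegrE ?normr_mx_entry.
rewrite /sqnormc mulr2n mulrDl mul1r lerD//.
  by have := e (lshift m i) (lshift m j); rewrite block_mxEul mxE.
by have := e (rshift m i) (lshift m j); rewrite block_mxEdl mxE.
Qed.

Lemma minimal_rank_element : exists2 P : 'M[C]_d, K (realify P) /\ P != 0 &
  forall A, K (realify A) -> A != 0 -> (\rank P <= \rank A)%N.
Proof.
have [[_ G1 _ _] _] := G_alg.
pose Q k := `[< exists P : 'M[C]_d, [/\ K (realify P), P != 0 & \rank P = k] >].
have Q0 : exists k, Q k.
  exists d; apply/asboolP; exists 1%:M; split; last by rewrite mxrank1.
    exact: closed_cone_group.
  by rewrite -mxrank_eq0 mxrank1 -lt0n; case: G_irr.
case: (ex_minnP Q0) => k /asboolP[P [KP P0 <-]] mink.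
by exists P => // A KA A0; apply: mink; apply/asboolP; exists A.
Qed.

(* By minimality of the rank, P M P with M in the cone vanishes or has the rank
   of P, so the determinant does not vanish on the compact set of normalized
   compressions to the image of P. *)
Lemma compression_bound (P : 'M[C]_d) : K (realify P) -> P != 0 ->
  (forall A, K (realify A) -> A != 0 -> (\rank P <= \rank A)%N) ->
  exists2 c : R, 0 < c & forall A, G A ->
    c * `|crealify (row_base P *m A *m col_base P)| ^+ (\rank P + \rank P) <=
    sqnormc (\det (row_base P *m A *m col_base P)).
Proof.
move=> KP P0 minP.
set r := \rank P; pose Bm := col_base P; pose Cm := row_base P.
have [E EB] := row_fullP (col_base_full P).
have [D CD] := row_freeP (row_base_free P).
have PE : Bm *m Cm = P by apply: mulmx_base.
pose T := [set M : 'M[R]_(r + r) |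
  K (crealify Bm *m M *m crealify Cm) /\ `|M| = 1].
have clT : closed T.
  apply: closedI.
    apply: (@closed_preimage _ _ (fun M => crealify Bm *m M *m crealify Cm)).
      exact: mulmx_lr_continuous.
    exact: closed_cone_closed.
  apply: (@closed_preimage _ _ (fun M : 'M[R]_(r + r) => `|M|) [set 1]).
    exact: norm_continuous.
  exact: closed_eq.
have [|||c c0 cT] := @sphere_min R _ _ T (fun M => `|\det M|) clT.
- by move=> M [].
- move=> x; apply: (@continuous_comp _ _ _ (fun M : 'M[R]_(r + r) => \det M) Num.norm).
    exact: det_continuous.
  exact: norm_continuous.
- move=> M [KM M1]; rewrite normr_gt0 -unitfE -unitmxE -row_free_unit.
  have [A AE] := closed_cone_realify KM.
  (* The one-sided inverses recover [M] from [A], so [A] is nonzero and minimality of the rank of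
     [P] applies to it; this makes [M] invertible. *)
  have MA : M = crealify E *m crealify A *m crealify D.
    rewrite -[crealify A]AE !mulmxA -crealifyM EB crealify1 mul1mx.
    by rewrite -mulmxA -crealifyM CD crealify1 mulmx1.
  have A0 : A != 0.
    apply/eqP => A0; move: M1; rewrite MA A0 crealify0 mulmx0 mul0mx normr0.
    by move=> /eqP; rewrite eq_sym oner_eq0.
  have rA : (r <= \rank A)%N by apply: (minP A _ A0); rewrite -AE; exact: KM.
  rewrite /row_free eqn_leq rank_leq_row /= (leq_trans (leq_add rA rA))//.
  rewrite -rank_crealify -[crealify A]AE -mulmxA (leq_trans (mxrankM_maxr _ _))//.
  exact: mxrankM_maxl.
exists c => // A GA; rewrite -/Bm -/Cm; set h := Cm *m A *m Bm.
have [H0|H0] := eqVneq (crealify h) 0.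
  rewrite H0 normr0 expr0n addn_eq0 andbb mxrank_eq0 (negPf P0) mulr0.
  exact: sqnormc_ge0.
have nH : 0 < `|crealify h| by rewrite normr_gt0.
have /cT : T (`|crealify h|^-1 *: crealify h).
  split; last by rewrite normrZ normfV normr_id mulVf// gt_eqF.
  rewrite -scalemxAr -scalemxAl; apply: closed_coneZ; rewrite -!crealifyM.
  have -> : Bm *m h *m Cm = P *m A *m P by rewrite -[in RHS]PE !mulmxA.
  rewrite !crealifyM; apply: (closed_coneM real_pointsM _ KP).
  exact: (closed_coneM real_pointsM KP (closed_cone_group GA)).
rewrite detZ det_crealify normrM normrX normfV normr_id.
rewrite (ger0_norm (sqnormc_ge0 _)) exprVn mulrC ler_pdivlMr//.
by rewrite exprn_gt0.
Qed.

Lemma minimal_rank_1 (P : 'M[C]_d) : K (realify P) -> P != 0 ->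
  (forall A, K (realify A) -> A != 0 -> (\rank P <= \rank A)%N) ->
  \rank P = 1%N.
Proof.
move=> KP P0 minP.
have [c c0 cG] := compression_bound KP P0 minP.
have [Ggrp Gcl] := G_alg.
set r := \rank P in c0 cG *; pose Bm := col_base P; pose Cm := row_base P.
have [E EB] := row_fullP (col_base_full P).
have [D CD] := row_freeP (row_base_free P).
rewrite -/Bm in EB; rewrite -/Cm in CD.
have r0 : (0 < r)%N by rewrite lt0n mxrank_eq0.
apply/eqP; rewrite eqn_leq r0 andbT leqNgt; apply/negP => r1.
pose i1 : 'I_r := Ordinal r0; pose i2 : 'I_r := Ordinal r1.
pose h A := Cm *m A *m Bm; pose f k A := h A k i1.
(* Both monomials have degree [r]; their common factor cancels in [f1 / f2], leaving the ratio of
   two entries in one column of [h]. *)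
pose f1 A := f i1 A * f i2 A ^+ r.-1; pose f2 A := f i2 A * f i2 A ^+ r.-1.
have polyh i j : polyfun (fun A => h A i j) by apply: polyfun_lmx.
(* The degree r monomials f k * f i2 ^ (r - 1) in the entries of h are bounded
   relative to det h. *)
have bound k A : G A -> \det (h A) != 0 ->
    ~ (2 ^+ r / c < sqnormc (f k A * f i2 A ^+ r.-1 / \det (h A))).
  move=> GA dA; apply/negP; rewrite -leNgt sqnormcM sqnormcV.
  have d0 : 0 < sqnormc (\det (h A)) by rewrite lt_def sqnormc_eq0 dA sqnormc_ge0.
  rewrite ler_pdivrMr// mulrAC ler_pdivlMr// mulrC.
  have entry i j := sqnormc_entry_le (h A) i j.
  have cN := cG A GA; rewrite -/h -/Bm -/Cm -/(h A) in cN.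
  move: entry cN; set N := `|crealify (h A)| => entry cN.
  (* Each of the [r] factors has squared modulus at most [2 * N ^+ 2], while [c * N ^+ (r + r)] is
     at most that of the determinant; this yields the constant [2 ^+ r / c]. *)
  apply: (@le_trans _ _ (c * (2 ^+ r * N ^+ (r + r)))).
    rewrite ler_pM2l// addnn -mul2n exprM -exprMn sqnormcM sqnormcX.
    rewrite -[X in _ <= _ ^+ X](prednK r0) exprS.
    apply: ler_pM; rewrite ?exprn_ge0 ?sqnormc_ge0//; first exact: entry.
    have N2 : 0 <= 2 * N ^+ 2 by rewrite mulr_ge0// sqr_ge0.
    by apply: lerXn2r; rewrite ?nnegrE ?sqnormc_ge0 ?N2//; apply: entry.
  by rewrite mulrCA ler_pM2l ?exprn_gt0.
have uE : ~ countable [set z : C | 2 ^+ r / c < sqnormc z].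
  by apply: uncountable_large; rewrite divr_ge0 ?exprn_ge0// ltW.
have polyf k : polyfun (fun A => f k A * f i2 A ^+ r.-1).
  by apply: polyfunM; [apply: polyh|apply: polyfunX; apply: polyh].
have polyd : polyfun (fun A => \det (h A)) by apply: polyfun_det.
have uC := @uncountable_complex R.
have [cs1 cs1P] := zariski_closed_ratio_finite uC Gcl (polyf i1) polyd uE (bound i1).
have [cs2 cs2P] := zariski_closed_ratio_finite uC Gcl (polyf i2) polyd uE (bound i2).
pose v := col i1 Bm.
have v0 : v != 0.
  apply/eqP => /(congr1 (mulmx E)); rewrite mulmx0 /v colE mulmxA EB mul1mx.
  by move=> /matrixP/(_ i1 0); rewrite !mxE !eqxx => /eqP; rewrite oner_eq0.
pose rho z := row i1 Cm - z *: row i2 Cm.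
have rho0 z : rho z != 0.
  apply/eqP => /(congr1 (mulmxr D)); rewrite /= mul0mx /rho mulmxBl -scalemxAl.
  rewrite !rowE -!(mulmxA _ Cm) CD !mulmx1 => /matrixP/(_ 0 i1); rewrite !mxE !eqxx /=.
  by rewrite mulr0 subr0 => /eqP; rewrite oner_eq0.
have row20 : row i2 Cm != 0.
  apply/eqP => /(congr1 (mulmxr D)); rewrite /= mul0mx rowE -(mulmxA _ Cm) CD mulmx1.
  by move=> /matrixP/(_ 0 i2); rewrite !mxE !eqxx /= => /eqP; rewrite oner_eq0.
have fE k A : row k Cm *m A *m v = (f k A)%:M.
  rewrite [LHS]mx11_scalar; congr (_%:M).
  by rewrite /v colE mulmxA -colE mxE -!row_mul mxE.
(* The first pair keeps the denominator [f i2] nonzero; the others exclude every possible value of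
   [f i1 / f i2]. *)
pose s := (row i2 Cm, v) :: [seq (rho (u / w), v) | u <- cs1, w <- cs2].
have [|A GA sA] := irreducible_pairs Ggrp G_conn G_irr (s := s).
  move=> p; rewrite inE => /orP[/eqP ->//|/allpairsP[[u w] [_ _ ->]]].
  by split=> //; apply: rho0.
have f20 : f i2 A != 0.
  have := sA (row i2 Cm, v); rewrite mem_head /= fE => /(_ isT).
  by apply: contra_neq => ->; apply/matrixP => i j; rewrite !mxE mul0rn.
have dA : \det (h A) != 0.
  rewrite -sqnormc_eq0 gt_eqF// (lt_le_trans _ (cG A GA))// mulr_gt0//.
  rewrite exprn_gt0// normr_gt0 -crealify0 (inj_eq (@crealify_inj _ _ _)).
  by apply: contra_neq f20 => hA; rewrite /f /h hA mxE.
have := sA (rho (f i1 A / f i2 A), v).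
have /[swap]/[apply] : (rho (f i1 A / f i2 A), v) \in s.
  rewrite inE; apply/orP; right; apply/allpairsP.
  exists (f1 A / \det (h A), f2 A / \det (h A)); split; [exact: cs1P|exact: cs2P|].
  congr (rho _, v); rewrite /f1 /f2 /=.
  have fr0 : f i2 A ^+ r.-1 != 0 by rewrite expf_neq0.
  exact: ratio_cancel.
rewrite /= /rho !mulmxBl -!scalemxAl !fE scale_scalar_mx -[_ / _ * _]mulrA.
by rewrite mulVf// mulr1 subrr eqxx.
Qed.
End RankOne.

(** * Property (S) and strong irreducibility *)

Section RealStructure.
Variables (R : realType) (d : nat).
Local Notation C := R[i].

Lemma realvecD n (A B : 'M[C]_(d, n)) : realvec (A + B) = realvec A + realvec B.
Proof.
rewrite /realvec add_col_mx; congr col_mx; apply/matrixP => i j;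
  by rewrite !mxE ?complexReD ?complexImD.
Qed.

Lemma realvecZ n (x : R) (A : 'M[C]_(d, n)) :
  realvec (real_complex R x *: A) = x *: realvec A.
Proof.
rewrite /realvec scale_col_mx; congr col_mx; apply/matrixP => i j;
  by rewrite !mxE ?complexReM ?complexImM /= ?mul0r ?subr0 ?addr0.
Qed.

(** The minus sign in [alpha] comes from the real part of [(a - ib)(x + iy)] being [ax + by]. *)
Lemma real_functional (phi : 'rV[R]_(d + d)) : exists alpha : 'rV[C]_d,
  forall v : 'cV[C]_d, (phi *m realvec v) 0 0 = complex.Re ((alpha *m v) 0 0).
Proof.
exists (\row_j Complex (lsubmx phi 0 j) (- rsubmx phi 0 j)) => v.
rewrite -[phi in LHS]hsubmxK mul_row_col [LHS]mxE [X in X + _]mxE [X in _ + X]mxE.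
rewrite [in RHS]mxE (big_morph _ (@complexReD R) (erefl _)) -big_split /=.
by apply: eq_bigr => j _; rewrite complexReM !mxE /= mulNr opprK.
Qed.

Lemma Im_div_imaginary (a b : C) :
  complex.Re a = 0 -> complex.Re b = 0 -> complex.Im (a / b) = 0.
Proof. by case: a b => a a' [b b'] /= -> ->; ring. Qed.

(** After division by [q], the numbers [p / q] and 1 form a real basis; [x] is found by comparing
    imaginary parts, then [y] by comparing real parts. *)
Lemma nonreal_span (p q z : C) : q != 0 -> complex.Im (p / q) != 0 ->
  exists x y : R, z = real_complex R x * p + real_complex R y * q.
Proof.
move=> q0; set t := p / q => t0.
pose s := z / q.
exists (complex.Im s / complex.Im t).
exists (complex.Re s - complex.Im s / complex.Im t * complex.Re t).
have -> : p = t * q by rewrite /t divfK.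
have -> : z = s * q by rewrite /s divfK.
rewrite mulrA -mulrDl; congr (_ * q); case: (s) (t) t0 => a b [c e] /= e0.
by apply/eqP; rewrite eq_complex /=; apply/andP; split; apply/eqP; field.
Qed.

End RealStructure.

Section Proposition.
Variables (R : realType) (d : nat) (G : set 'M[R[i]]_d).
Hypotheses (hd : (2 <= d)%N) (G_alg : algebraic_group G)
  (G_conn : zariski_connected G) (G_irr : irreducible_action G).
Local Notation C := R[i].
Local Notation K := (closed_cone (real_points G)).
Local Notation coef rho A v := ((rho *m A *m v) 0 0).

(** The ratio omits the uncountable set of nonreal numbers. Filtering the list keeps its members
    real, as needed for property (S). *)
Lemma real_ratio_finite (rho sigma : 'rV[C]_d) (v u : 'cV[C]_d) :
  (forall A, G A -> coef sigma A u != 0 ->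
    complex.Im (coef rho A v / coef sigma A u) = 0) ->
  exists cs : seq C, (forall c, c \in cs -> complex.Im c = 0) /\
    forall A, G A -> coef sigma A u != 0 -> coef rho A v / coef sigma A u \in cs.
Proof.
move=> GR; have [_ Gcl] := G_alg.
have [A GA A0|cs csP] := zariski_closed_ratio_finite (@uncountable_complex R) Gcl
  (polyfun_lmx rho v 0 0) (polyfun_lmx sigma u 0 0) (@uncountable_nonreal R).
  by rewrite /= GR ?eqxx.
exists [seq c <- cs | complex.Im c == 0]; split=> [c|A GA A0].
  by rewrite mem_filter => /andP[/eqP].
by rewrite mem_filter csP// GR ?eqxx.
Qed.

Lemma coef_eq0 (rho : 'rV[C]_d) A (v : 'cV[C]_d) :
  (coef rho A v == 0) = (rho *m A *m v == 0).
Proof. by rewrite mx11_eq0. Qed.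

Lemma coef_lin (rho : 'rV[C]_d) A (v u : 'cV[C]_d) x y :
  coef rho A (x *: v + y *: u) = x * coef rho A v + y * coef rho A u.
Proof.
rewrite mulmxDr -!scalemxAr [LHS]mxE.
by congr (_ + _); rewrite [LHS]mxE.
Qed.

Lemma outer_mx_apply (w : 'cV[C]_d) (rho : 'rV[C]_d) A (v : 'cV[C]_d) :
  w *m rho *m (A *m v) = coef rho A v *: w.
Proof. by rewrite -mulmxA (mulmxA rho) [in LHS](mx11_scalar (rho *m A *m v)) mul_mx_scalar. Qed.

Lemma rank_one_element : exists (w : 'cV[C]_d) (rho : 'rV[C]_d),
  [/\ w != 0, rho != 0 & K (realify (w *m rho))].
Proof.
have [P [KP P0] minP] := minimal_rank_element G_alg G_irr.
have rP := minimal_rank_1 G_alg G_conn G_irr KP P0 minP.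
move: KP P0; rewrite -(mulmx_base P).
move: (col_base P) (row_base P); rewrite rP => w rho KP P0.
exists w, rho; split=> //; apply: contraNneq P0 => ->.
  by rewrite mul0mx.
by rewrite mulmx0.
Qed.

Lemma closed_cone_rank_ge2 M : K M -> M != 0 -> (2 <= \rank M)%N.
Proof.
move=> KM; have [A ->] := closed_cone_realify KM.
rewrite crealifyE rank_crealify -mxrank_eq0 rank_crealify.
by case: (\rank A) => // n _; rewrite addSn addnS.
Qed.

Lemma mul_col_row_neq0 (w : 'cV[C]_d) (rho : 'rV[C]_d) :
  w != 0 -> rho != 0 -> w *m rho != 0.
Proof.
move=> /cV0Pn[i wi] /rV0Pn[j rj]; apply/eqP => /matrixP/(_ i j).
by rewrite !mxE big_ord1 => /eqP; rewrite mulf_eq0 (negPf wi) (negPf rj).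
Qed.

Lemma rank_realify_col_row (w : 'cV[C]_d) (rho : 'rV[C]_d) :
  w != 0 -> rho != 0 -> \rank (realify (w *m rho)) = 2%N.
Proof.
move=> w0 rho0; have := mul_col_row_neq0 w0 rho0.
rewrite crealifyE rank_crealify -mxrank_eq0.
by have := mulmx_max_rank w rho; case: (\rank _) => [|[|]].
Qed.

Lemma proximal_dim_2 : proximal_dim (real_points G) = 2%N.
Proof.
have [w [rho [w0 rho0 KP]]] := rank_one_element.
have r2 := rank_realify_col_row w0 rho0.
have n2 : nonzero_ranks (real_points G) 2%N.
  exists (realify (w *m rho)) => //; split=> //= /eqP.
  by rewrite -mxrank_eq0 r2.
have min2 k : nonzero_ranks (real_points G) k -> (2 <= k)%N.
  by move=> [M [KM /eqP M0] <-]; apply: closed_cone_rank_ge2.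
apply: xget_unique; first by split.
move=> k [kn kmin]; apply/eqP; rewrite eqn_leq min2// andbT.
exact: kmin.
Qed.

Lemma real_points_property_S : property_S (real_points G).
Proof.
move=> W; rewrite proximal_dim_2 => dW.
have [Ggrp _] := G_alg; have [GU _ _ _] := Ggrp.
have dfull : \dim {: 'cV[R]_(d + d)} = (d + d)%N by rewrite dimvf /dim /= muln1.
have [|phi1 phi10 phi1W] := @annihilator_neq0 _ _ W.
  by apply/eqP => Wf; move: dW; rewrite Wf dfull; lia.
have [j phij] : exists j, phi1 0 j != 0 by apply/rV0Pn.
pose e : 'cV[R]_(d + d) := delta_mx j 0.
have phie : (phi1 *m e) 0 0 != 0 by rewrite -colE mxE.
(* Requiring [phi2] to vanish at [e] as well, where [phi1] does not, makes the two functionals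
   independent; [W + <[e]>] is proper by dimension. *)
have [|phi2 phi20 phi2W] := @annihilator_neq0 _ _ (W + <[e]>)%VS.
  apply/eqP => Wf; have := dimv_sum_cap W <[e]>%VS.
  by rewrite Wf dfull dW dim_vline; case: (e != 0) => /=; lia.
have phi2e : phi2 *m e = 0 by apply: phi2W; apply: (subvP (addvSr _ _)); apply: memv_line.
have {}phi2W x : x \in W -> phi2 *m x = 0.
  by move=> xW; apply: phi2W; apply: (subvP (addvSl _ _)).
have [a1 a1E] := real_functional phi1; have [a2 a2E] := real_functional phi2.
have a20 : a2 != 0.
  apply/eqP => a20; case/eqP: phi20; apply/matrixP => i k; rewrite !ord1 mxE.
  have [v vE] := realvec_surj (delta_mx k 0 : 'cV[R]_(d + d)).
  have := a2E v; rewrite -vE -colE mxE => ->.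
  by rewrite a20 mul0mx mxE.
have a1a2 c : complex.Im c = 0 -> a1 - c *: a2 != 0.
  move=> c0; apply/eqP => /subr0_eq a1c; case/eqP: phie.
  have [v vE] := realvec_surj e; move: phi2e; rewrite vE => phi2e.
  rewrite a1E a1c -scalemxAl mxE complexReM c0 mul0r subr0 -a2E phi2e mxE mulr0//.
have [w [rho [w0 rho0 KP]]] := rank_one_element.
apply: contrapT => nV.
have meet A : G A -> coef a2 A w != 0 -> complex.Im (coef a1 A w / coef a2 A w) = 0.
  move=> GA q0.
  (* [V] is the complex line through [A *m w] and belongs to the limit images, so by assumption it
     meets [W] in some nonzero [z *: (A *m w)]. Both functionals are then purely imaginary there, so
     their ratio is real. *)
  pose V := limg (linfun (mulmx (realify (A *m w *m rho)) : 'cV[R]_(d + d) -> 'cV[R]_(d + d))).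
  have VW : (V :&: W)%VS != 0%VS.
    apply/eqP => VW0; apply: nV; exists V => //.
    exists (realify (A *m w *m rho)); last by [].
    split.
      rewrite -mulmxA crealifyE crealifyM.
      exact: (closed_coneM (real_pointsM G_alg) (closed_cone_group GA) KP).
    rewrite proximal_dim_2; apply: rank_realify_col_row => //.
    apply: contraNneq w0 => Aw; rewrite -[w]mul1mx -(mulVmx (GU _ GA)) -mulmxA Aw.
    by rewrite mulmx0.
  have := memv_pick (V :&: W)%VS; rewrite memv_cap => /andP[+ xW].
  have x0 : vpick (V :&: W)%VS != 0 by rewrite vpick0.
  move: (vpick _) x0 xW => x x0 xW /memv_imgP[y _]; rewrite lfunE /=.
  have [v ->] := realvec_surj y; rewrite crealifyE crealify_realvec.
  pose z := (rho *m v) 0 0.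
  have -> : A *m w *m rho *m v = z *: (A *m w).
    by rewrite -mulmxA [rho *m v]mx11_scalar mul_mx_scalar.
  move=> xE; have z0 : z != 0.
    by apply: contraNneq x0 => z0; rewrite xE z0 scale0r realvec_eq0.
  have Re1 : complex.Re (z * coef a1 A w) = 0.
    have := a1E (z *: (A *m w)); rewrite -xE phi1W// mxE.
    by rewrite -scalemxAr mulmxA mxE => <-.
  have Re2 : complex.Re (z * coef a2 A w) = 0.
    have := a2E (z *: (A *m w)); rewrite -xE phi2W// mxE.
    by rewrite -scalemxAr mulmxA mxE => <-.
  by have := Im_div_imaginary Re1 Re2; rewrite -mulf_div divff// mul1r.
have [cs [csR csP]] := real_ratio_finite meet.
have [|A GA sA] := irreducible_pairs Ggrp G_conn G_irr
   (s := (a2, w) :: [seq (a1 - c *: a2, w) | c <- cs]).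
  move=> p; rewrite inE => /orP[/eqP ->//|/mapP[c ccs ->]]; split=> //.
  by apply: a1a2; apply: csR.
have q0 : coef a2 A w != 0.
  by rewrite coef_eq0; apply: (sA (a2, w)); rewrite mem_head.
have := sA (a1 - (coef a1 A w / coef a2 A w) *: a2, w).
rewrite inE map_f ?orbT; last exact: csP.
move=> /(_ isT) /=; rewrite !mulmxBl -!scalemxAl mx11_eq0 mxE [X in _ + X]mxE.
by rewrite [X in _ - X]mxE divfK// subrr eqxx.
Qed.


(** For fixed [u], the condition that [M *m u] lies in a finite union of subspaces is a finite union
    of closed linear conditions on [M]. *)
Lemma closed_cone_stable (s : seq {vspace 'cV[R]_(d + d)}) :
  let U := [set v : 'cV[R]_(d + d) | exists2 V, V \in s & v \in V] in
  (forall g, real_points G g -> mulmx g @` U `<=` U) ->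
  forall M u, K M -> U u -> U (M *m u).
Proof.
move=> U GU M u KM Uu; move: M KM.
apply: (@closed_cone_sub _ _ _ [set M | U (M *m u)]); last first.
  move=> l g Gg; have [|V Vs gV] := GU g Gg (g *m u); first by exists u.
  by exists V => //; rewrite -scalemxAl memvZ.
have [Q QV] : exists Q : {vspace 'cV[R]_(d + d)} -> 'M[R]_(d + d),
    forall (V : {vspace 'cV[R]_(d + d)}) x, (x \in V) = (Q V *m x == 0).
  suff /choice[Q QP] : forall V : {vspace 'cV[R]_(d + d)},
    exists Q : 'M[R]_(d + d), forall x, (x \in V) = (Q *m x == 0) by exists Q.
  exact: vspace_kernel_mx.
rewrite (_ : [set M | _] = \big[setU/set0]_(V <- s) [set M | Q V *m M *m u = 0]).
  apply: closed_bigsetU => V _; apply: closed_mx0; exact: mulmx_lr_continuous.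
rewrite -bigcup_seq; apply/seteqP; split=> M /= [V Vs].
  by rewrite QV mulmxA => /eqP VM; exists V.
by move=> VM; exists V; rewrite // QV mulmxA VM.
Qed.

(** Among [(size s).+1] points of the line two lie in one [V]; their difference is a nonzero
    multiple of [u]. *)
Lemma affine_line_pigeonhole (s : seq {vspace 'cV[R]_(d + d)}) (u v : 'cV[R]_(d + d)) :
  (forall t : R, exists2 V, V \in s & v + t *: u \in V) ->
  exists2 V, V \in s & (u \in V) /\ (v \in V).
Proof.
move=> line.
have [f fP] : exists f : R -> 'I_(size s), forall t, v + t *: u \in nth 0%VS s (f t).
  suff /choice[f fP] : forall t : R, exists k : 'I_(size s), v + t *: u \in nth 0%VS s k.
    by exists f.
  move=> t; have [V Vs tV] := line t; have ks : (index V s < size s)%N by rewrite index_mem.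
  by exists (Ordinal ks); rewrite /= nth_index.
have [k [l [kl fkl]]] : exists k l : 'I_(size s).+1, k != l /\ f k%:R = f l%:R.
  apply: contrapT => inj.
  have fi : injective (fun k : 'I_(size s).+1 => f k%:R).
    move=> k l fkl; apply: contrapT => /eqP kl; apply: inj; by exists k, l.
  by have := leq_card _ fi; rewrite !card_ord ltnn.
have kl0 : (k%:R - l%:R : R) != 0 by rewrite subr_eq0 eqr_nat.
exists (nth 0%VS s (f k%:R)); first exact: mem_nth.
have uV : u \in nth 0%VS s (f k%:R).
  have -> : u = (k%:R - l%:R : R)^-1 *: ((v + k%:R *: u) - (v + l%:R *: u)).
    by rewrite opprD addrACA subrr add0r -scalerBl scalerA mulVf// scale1r.
  by rewrite memvZ// memvB// fkl.
split=> //; rewrite -[v](addrK (k%:R *: u)) memvB ?fP// memvZ//.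
Qed.

Lemma real_points_strongly_irreducible : strongly_irreducible (real_points G).
Proof.
move=> s s0 sV U GU.
have [Ggrp _] := G_alg; have [_ G1 _ _] := Ggrp.
have KU := closed_cone_stable GU.
have [w [rho [w0 rho0 KP]]] := rank_one_element.
(* It suffices to trap an orbit G u in a finite union of complex hyperplanes. *)
suff [u [u0 uG]] : exists u : 'cV[C]_d, u != 0 /\
    exists chi : {vspace 'cV[R]_(d + d)} -> 'rV[C]_d,
    (forall V, V \in s -> chi V != 0) /\
    forall A, G A -> exists2 V, V \in s & chi V *m A *m u = 0.
  have [chi [chi0 chiG]] := uG.
  have [|A GA sA] := irreducible_pairs Ggrp G_conn G_irr (s := [seq (chi V, u) | V <- s]).
    by move=> p /mapP[V Vs ->]; split=> //; apply: chi0.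
  have [V Vs /eqP VA] := chiG A GA.
  by have := sA (chi V, u) (map_f _ Vs); rewrite /= VA.
(* If U contains the complex line of u, then chi V annihilates the largest
   complex subspace of V; otherwise V lies in a complex line, annihilated by
   chi V. *)
have [[u [u0 uU]]|nplane] := pselect (exists u : 'cV[C]_d, u != 0 /\
    forall z : C, U (realvec (z *: u))).
  exists u; split=> //.
  have [chi chiP] : exists chi : {vspace 'cV[R]_(d + d)} -> 'rV[C]_d,
      forall V, V \in s -> chi V != 0 /\
        forall v, (forall z : C, realvec (z *: v) \in V) -> chi V *m v = 0.
    suff /choice[chi chiP] : forall V : {vspace 'cV[R]_(d + d)}, exists chi : 'rV[C]_d,
        V \in s -> chi != 0 /\
          forall v, (forall z : C, realvec (z *: v) \in V) -> chi *m v = 0.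
      by exists chi.
    move=> V; have [Vs|nVs] := boolP (V \in s); last by exists 0.
    have [|a x y xV yV z|W WP] := @vspace_of_set _ _
      [set v : 'cV[C]_d | forall z : C, realvec (z *: v) \in V].
    - by move=> z; rewrite scaler0 (_ : realvec 0 = 0) ?mem0v//; apply/eqP; rewrite realvec_eq0.
    - by rewrite scalerDr scalerA realvecD memvD.
    have [|chi chi0 chiW] := @annihilator_neq0 _ _ W.
      apply/eqP => Wf; have [_ /eqP] := sV V Vs; apply; apply/vspaceP => x.
      rewrite memvf; have [v ->] := realvec_surj x.
      have /WP/(_ 1) : v \in W by rewrite Wf memvf.
      by rewrite scale1r.
    by exists chi => _; split=> // v vV; apply: chiW; apply/WP.
  exists chi; split=> [V /chiP[]//|A GA].
  have line z : U (realvec (z *: (A *m u))).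
    rewrite scalemxAr -crealify_realvec; apply: (GU (realify A)); first by exists A.
    by exists (realvec (z *: u)) => //; apply: uU.
  (* A single [V] contains [A *m u] and [i] times it, hence the whole complex line of [A *m u]. *)
  have [|V Vs [iV oneV]] := @affine_line_pigeonhole s
    (realvec ('i%C *: (A *m u))) (realvec (A *m u)).
    move=> t; have [V Vs tV] := line (1 + real_complex R t * 'i%C); exists V => //.
    by rewrite -realvecZ -realvecD scalerA -[X in realvec (X + _)]scale1r -scalerDl.
  exists V => //; have [_ chiV] := chiP V Vs; rewrite -mulmxA; apply: chiV => z.
  have -> : z *: (A *m u) = real_complex R (complex.Re z) *: (A *m u) +
      real_complex R (complex.Im z) *: ('i%C *: (A *m u)).
    rewrite scalerA -scalerDl; congr (_ *: _).
    by rewrite [_ * 'i%C]mulrC; exact: complexE.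
  by rewrite realvecD; apply: memvD; rewrite realvecZ; apply: memvZ.
(* If some ratio [coef rho A v / coef rho A e] were nonreal, [w *m rho *m A] would map the real span
   of [v] and [e] onto the complex line of [w], placing that line in [U]. So the ratios are real and
   finite in number, which for [v] outside the line of [e] contradicts [irreducible_pairs]. *)
have collinear V : V \in s -> exists e : 'cV[C]_d,
    [/\ e != 0, realvec e \in V & forall v, realvec v \in V -> exists c, v = c *: e].
  move=> Vs; have [V0 _] := sV V Vs.
  have [e eE] := realvec_surj (vpick V).
  have e0 : e != 0 by rewrite -realvec_eq0 -eE vpick0.
  have eV : realvec e \in V by rewrite -eE memv_pick.
  exists e; split=> // v vV; apply: contrapT => /forallNP nc.
  have rR A : G A -> coef rho A e != 0 -> complex.Im (coef rho A v / coef rho A e) = 0.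
    move=> GA q0; apply: contrapT => /eqP im0; apply: nplane; exists w; split=> // z.
    have [x [y ->]] := nonreal_span z q0 im0.
    have -> : realvec ((real_complex R x * coef rho A v + real_complex R y * coef rho A e) *: w) =
        realify (w *m rho) *m (realify A *m (x *: realvec v + y *: realvec e)).
      rewrite -!realvecZ -realvecD !crealifyE !crealify_realvec; congr realvec.
      by rewrite outer_mx_apply coef_lin.
    apply: KU => //; apply: (GU (realify A)); first by exists A.
    exists (x *: realvec v + y *: realvec e) => //; exists V => //.
    by rewrite memvD// memvZ.
  have [cs [_ csP]] := real_ratio_finite rR.
  have [|A GA sA] := irreducible_pairs Ggrp G_conn G_irr
     (s := (rho, e) :: [seq (rho, v - c *: e) | c <- cs]).
    move=> p; rewrite inE => /orP[/eqP ->//|/mapP[c ccs ->]]; split=> //=.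
    by rewrite subr_eq0; apply/eqP; apply: nc.
  have q0 : coef rho A e != 0.
    by rewrite coef_eq0; apply: (sA (rho, e)); rewrite mem_head.
  have := sA (rho, v - (coef rho A v / coef rho A e) *: e).
  rewrite inE map_f ?orbT; last exact: csP.
  move=> /(_ isT) /=; rewrite mulmxBr -scalemxAr mx11_eq0 mxE [X in _ + X]mxE.
  by rewrite [X in _ - X]mxE divfK// subrr eqxx.
have [V0 V0s] : exists V, V \in s by case: (s) s0 => // V s' _; exists V; rewrite mem_head.
have [u [u0 uV0 _]] := collinear V0 V0s.
exists u; split=> //.
have [chi chiP] : exists chi : {vspace 'cV[R]_(d + d)} -> 'rV[C]_d,
    forall V, V \in s -> chi V != 0 /\ forall v, realvec v \in V -> chi V *m v = 0.
  suff /choice[chi chiP] : forall V : {vspace 'cV[R]_(d + d)}, exists chi : 'rV[C]_d,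
      V \in s -> chi != 0 /\ forall v, realvec v \in V -> chi *m v = 0.
    by exists chi.
  move=> V; have [Vs|nVs] := boolP (V \in s); last by exists 0.
  have [e [e0 eV Ve]] := collinear V Vs.
  have [|chi chi0 chie] := @annihilator_neq0 _ _ <[e]>%VS.
    (* A complex line is proper because [d] is at least 2. *)
    apply/eqP => ef; have := dim_vline e; rewrite ef e0 dimvf /dim /= muln1.
    by move=> d1; move: hd; rewrite d1.
  exists chi => _; split=> // v /Ve[c ->].
  by apply: chie; rewrite memvZ// memv_line.
exists chi; split=> [V /chiP[]//|A GA].
have GA' : real_points G (realify A) by exists A.
have [|V Vs AV] := GU _ GA' (realvec (A *m u)).
  exists (realvec u); first by exists V0.
  by rewrite crealifyE crealify_realvec.
by exists V => //; have [_] := chiP V Vs; rewrite -mulmxA; apply.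
Qed.

End Proposition.

Theorem proposition2p5 (R : realType) (d : nat) (hd : (2 <= d)%N)
    (G : set 'M[R[i]]_d)
    (G_alg : algebraic_group G)
    (G_conn : zariski_connected G)
    (G_irr : irreducible_action G) :
  [/\ strongly_irreducible (real_points G),
      proximal_dim (real_points G) = 2%N &
      property_S (real_points G)].
Proof.
split.
- exact: real_points_strongly_irreducible.
- exact: proximal_dim_2.
- exact: real_points_property_S.
Qed.
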